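(* Let $G'$ and $G$ be Lie groupoids, let $\phi:G'\to G$ be a hypercover, and let $R$ be a representation up to homotopy of $G$ on a bounded graded vector bundle $E=\bigoplus_{n\in\mathbb{Z}}E_n\to G_0$. Then the pullback map $\phi^*:H(G,E)\to H(G',\phi^*E)$ is an isomorphism.
   Context: Vector bundles are real, smooth and of finite rank; graded vector bundles are bounded from above and below. Nerve. For a Lie groupoid $G$ with objects $G_0$ and arrows $G_1$, $G_n$ is the manifold of chains $g=(x_n\xleftarrow{g_n}x_{n-1}\leftarrow\cdots\xleftarrow{g_1}x_0)$ of $n$ composable arrows. Let $[n]=\{0,\dots,n\}$. For an order-preserving $\theta:[p]\to[n]$, $g\theta\in G_p$ is the chain $x_{\theta(p)}\leftarrow\cdots\leftarrow x_{\theta(0)}$ formed by the corresponding composites (or identities). $\delta_i:[n-1]\to[n]$ is the injection missing $i$, and $d_ig=g\delta_i$. $\iota_p:[p]\to[n]$ is $\iota_p(i)=i$, and $\tau_q:[q]\to[n]$ is $\tau_q(i)=n-q+i$. Write $s(g)=x_0$ and $t(g)=x_n$. A simplex $g$ is degenerate if one of the arrows $g_i$ is an identity. Hypercover. A Lie groupoid morphism $\phi:G'\to G$ (smooth functor) is a hypercover if $\phi_0:G'_0\to G_0$ is a surjective submersion and the square with sides $\phi_1:G'_1\to G_1$, $\phi_0\times\phi_0:G_0'\times G_0'\to G_0\times G_0$ and the two maps (target, source) is cartesian, i.e. $G'_1\to (G'_0\times G'_0)\times_{G_0\times G_0}G_1$ is a diffeomorphism. Representation up to homotopy. $R=(R_m)_{m\ge0}:G\curvearrowright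 E$ consists of smooth sections $R_m\in\Gamma(G_m,\hom^{m-1}(s^*E,t^*E))$, i.e. for $g\in G_m$ linear maps $R_m^g:E_n^{s(g)}\to E_{n+m-1}^{t(g)}$, smooth in $g$, such that: (RH1) $R_1^{g}=\mathrm{id}$ if $g$ is a unit arrow, and $R_m^g=0$ whenever $m\ge2$ and $g$ is degenerate; (RH2) $\sum_{k=1}^{m-1}(-1)^kR_{m-1}^{g\delta_k}=\sum_{k=0}^m(-1)^kR_{m-k}^{g\tau_{m-k}}\circ R_k^{g\iota_k}$ for all $g\in G_m$, $m\ge0$. Cohomology. $C^{i,j}(G,E)=\Gamma(G_i,t^*E_{-j})$ and $C^n(G,E)=\bigoplus_{i+j=n}C^{i,j}(G,E)$. The differential is $d=\sum_{m\ge0}d_m$ where, for $c\in C^{i,j}(G,E)$, $d_m(c)\in C^{i+m,j-m+1}(G,E)$ is given by $d_m(c)(g)=(-1)^jR_m^{g\tau_m}c(g\iota_i)$ for $m\ne1$, $g\in G_{i+m}$, and $d_1(c)(g)=(-1)^jR_1^{g\tau_1}c(d_{i+1}g)+(-1)^{i+j+1}\sum_{r=0}^i(-1)^rc(d_rg)$ for $g\in G_{i+1}$. One has $d^2=0$, and $H(G,E)$ is the cohomology of $(C(G,E),d)$. Pullback. $\phi^*E$ is the pullback of $E$ along $\phi_0$, with the representation up to homotopy $(\phi^*R)_m^{g'}=R_m^{\phi(g')}$ of $G'$; the map $\phi^*$ in cohomology is induced by the cochain map $C(G,E)\to C(G',\phi^*E)$, $(\phi^*c)(g')=c(\phi(g'))$.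 *)

(* Defs.v *)
From HB Require Import structures.
From mathcomp Require Import all_boot all_order all_algebra.
From mathcomp Require Import all_classical all_reals all_analysis.
Import Order.TTheory GRing.Theory Num.Theory numFieldNormedType.Exports.
Set Implicit Arguments.
Unset Strict Implicit.
Unset Printing Implicit Defensive.
Local Open Scope classical_set_scope.
Local Open Scope ring_scope.

Section Smooth.
Variable R : realType.

Section diff_class.
Variables (V W : normedModType R).

Fixpoint diff_class (k : nat) (U : set V) (f : V -> W) : Prop :=
  if k is k'.+1 then
    (forall x, U x -> differentiable f x) /\
    (forall v, diff_class k' U (fun x => 'D_v f x))
  else forall x, U x -> {for x, continuous f}.

Definition smooth (U : set V) (f : V -> W) : Prop := forall k, diff_class k U f.

End diff_class.

Lemma near_eq_differentiable (V W : normedModType R) (f g : V -> W) x :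
  (\forall y \near x, f y = g y) -> differentiable f x -> differentiable g x.
Proof.
move=> E df.
have /diff_locallyP[cd eqd] := df.
have eg : g \o shift x = cst (g x) + 'd f x +o_ 0 id.
  apply/eqaddoP => e e0.
  move/eqaddoP : eqd => /(_ _ e0) eqd.
  have E0 : \forall h \near (0 : V), f (h + x) = g (h + x).
    by move: E; rewrite (near_shift 0) /=; apply: filterS => h; rewrite subr0.
  apply: filterS2 eqd E0 => h h1 fgh; apply: le_trans h1.
  by rewrite !fctE /= fgh (nbhs_singleton E).
apply/diff_locallyP; have dg := diff_unique cd eg.
by rewrite dg; split.
Qed.

Section basic.
Variables (V W : normedModType R).
Implicit Types (U : set V) (f g : V -> W).

Lemma diff_class_cover k U f :
  (forall x, U x -> exists2 A, A x & diff_class k A f) -> diff_class k U f.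
Proof.
elim: k f => [|k IH] f H /=.
  by move=> x /H[A Ax cA]; exact: cA.
split=> [x /H[A Ax [dA _]]|v]; first exact: dA.
by apply: IH => x /H[A Ax [_ Hv]]; exists A => //; exact: Hv.
Qed.

Lemma diff_class_sub k U U' f : U' `<=` U -> diff_class k U f ->
  diff_class k U' f.
Proof. by move=> sU Uf; apply: diff_class_cover => x /sU Ux; exists U. Qed.

Lemma open_near_eq U f g x : open U -> (forall x, U x -> f x = g x) ->
  U x -> \forall y \near x, f y = g y.
Proof.
by move=> oU fg Ux; near=> y; apply: fg; near: y; exact: open_nbhs_nbhs.
Unshelve. all: by end_near. Qed.

Lemma diff_class_ext k U f g : open U -> (forall x, U x -> f x = g x) ->
  diff_class k U f -> diff_class k U g.
Proof.
move=> oU; elim: k f g => [|k IH] f g fg /=.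
  move=> cf x Ux.
  have := cf x Ux; rewrite /prop_for /continuous_at (fg _ Ux) => h.
  by apply: cvg_trans h; apply: near_eq_cvg; apply: open_near_eq oU _ Ux => y /fg.
move=> [df Df]; split => [x Ux|v].
  exact: near_eq_differentiable (open_near_eq oU fg Ux) (df x Ux).
apply: IH (Df v) => x Ux; apply: near_eq_derive.
exact: open_near_eq oU fg Ux.
Qed.

Lemma diff_classW k U f : diff_class k.+1 U f -> diff_class k U f.
Proof.
elim: k f => [|k IH] f [df Df]; first by move=> x /df /differentiable_continuous.
by split=> // v; apply: IH.
Qed.

Lemma diff_class_cst k U (w : W) : diff_class k U (fun=> w).
Proof.
elim: k w => [|k IH] w /=; first by move=> x _; exact: cst_continuous.
split=> [x _|v]; first exact: differentiable_cst.
have -> : (fun x : V => 'D_v (fun=> w) x) = fun=> 0.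
  by apply/funext => x; rewrite derive_cst.
exact: IH.
Qed.

Lemma diff_classD k U f g : open U -> diff_class k U f -> diff_class k U g ->
  diff_class k U (fun x => f x + g x).
Proof.
move=> oU; elim: k f g => [|k IH] f g.
  by move=> cf cg x Ux; apply: cvgD; [exact: cf|exact: cg].
move=> [df Df] [dg Dg]; split=> [x Ux|v].
  by apply: differentiableD; [exact: df|exact: dg].
apply: diff_class_ext (IH _ _ (Df v) (Dg v)) => // x Ux.
by rewrite -deriveD //; apply: diff_derivable; [exact: df|exact: dg].
Qed.

Lemma diff_classZ k U f (a : R) : open U -> diff_class k U f ->
  diff_class k U (fun x => a *: f x).
Proof.
move=> oU; elim: k f => [|k IH] f.
  by move=> cf x Ux; apply: cvgZr; exact: cf.
move=> [df Df]; split=> [x Ux|v]; first by apply: differentiableZ; exact: df.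
apply: diff_class_ext (IH _ (Df v)) => // x Ux.
by rewrite -deriveZ //; apply: diff_derivable; exact: df.
Qed.

Lemma diff_class_sum k U (I : Type) (r : seq I) (F : I -> V -> W) : open U ->
  (forall i, diff_class k U (F i)) ->
  diff_class k U (fun x => \sum_(i <- r) F i x).
Proof.
move=> oU H; elim: r => [|i r IH].
  by under eq_fun do rewrite big_nil; exact: diff_class_cst.
by under eq_fun do rewrite big_cons; exact: diff_classD.
Qed.

End basic.

Section scale.
Variables (V : normedModType R) (m n : nat).
Implicit Types (h : V -> 'rV[R]_n) (w : V -> 'rV[R]_m).

Lemma differentiable_coordZ h w (j : 'I_n) x :
  differentiable h x -> differentiable w x ->
  differentiable (fun x => h x 0 j *: w x) x /\
  forall v, 'D_v (fun x => h x 0 j *: w x) x =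
    ('D_v h x) 0 j *: w x + h x 0 j *: 'D_v w x.
Proof.
move=> dh dw.
have dhj : differentiable (fun x => h x 0 j) x.
  apply: (@differentiable_comp _ _ _ _ h (fun M : 'rV[R]_n => M 0 j)) => //.
  exact: differentiable_coord.
have dwi i : differentiable (fun x => w x 0 i) x.
  apply: (@differentiable_comp _ _ _ _ w (fun M : 'rV[R]_m => M 0 i)) => //.
  exact: differentiable_coord.
have E : (fun x => h x 0 j *: w x) =
    \sum_(i < m) (fun x => (h x 0 j * w x 0 i) *: (delta_mx 0 i : 'rV[R]_m)).
  apply/funext => y; rewrite fct_sumE [w y in LHS]row_sum_delta scaler_sumr.
  by apply: eq_bigr => i _; rewrite scalerA.
have dZ : differentiable (fun x => h x 0 j *: w x) x.
  rewrite E; apply: differentiable_sum => i.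
  apply: differentiableZl; apply: differentiableM => //.
split=> // v.
have dv := diff_derivable dZ.
rewrite derive_mx //; apply/rowP => i; rewrite !mxE.
have -> : (fun t => (h t 0 j *: w t) 0 i) = (fun t => h t 0 j) * (fun t => w t 0 i).
  by apply/funext => t; rewrite !mxE.
rewrite deriveM; [|exact: (diff_derivable dhj)|exact: (diff_derivable (dwi i))].
rewrite (derive_mx (diff_derivable dh)) (derive_mx (diff_derivable dw)) !mxE.
by rewrite addrC; congr (_ + _); rewrite mulrC.
Qed.

Lemma diff_class_coordZ k U h w (j : 'I_n) : open U ->
  diff_class k U h -> diff_class k U w ->
  diff_class k U (fun x => h x 0 j *: w x).
Proof.
move=> oU; elim: k h w => [|k IH] h w.
  move=> ch cw x Ux; apply: cvgZ; last exact: cw.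
  apply: (@continuous_comp _ _ _ h (fun M : 'rV[R]_n => M 0 j)); first exact: ch.
  exact: coord_continuous.
move=> Hh Hw; have [dh Dh] := Hh; have [dw Dw] := Hw; split=> [x Ux|v].
  by have [] := differentiable_coordZ j (dh _ Ux) (dw _ Ux).
apply: (@diff_class_ext _ _ _ _
  (fun x => ('D_v h x) 0 j *: w x + h x 0 j *: 'D_v w x)) => //.
  by move=> x Ux; have [_ ->] := differentiable_coordZ j (dh _ Ux) (dw _ Ux).
apply: diff_classD => //; apply: IH.
- exact: Dh.
- exact: (diff_classW Hw).
- exact: (diff_classW Hh).
- exact: Dw.
Qed.

End scale.

Lemma diff_class_comp (V : normedModType R) n m k (U : set V)
    (A : set 'rV[R]_n) (f : V -> 'rV[R]_n) (g : 'rV[R]_n -> 'rV[R]_m) :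
  open U -> (forall x, U x -> A (f x)) ->
  diff_class k U f -> diff_class k A g -> diff_class k U (g \o f).
Proof.
move=> oU UA; elim: k g => [|k IH] g.
  by move=> cf cg x Ux; apply: continuous_comp; [exact: cf|apply: cg; exact: UA].
move=> Hf Hg; have [df Df] := Hf; have [dg Dg] := Hg; split=> [x Ux|v].
  by apply: differentiable_comp; [exact: df|apply: dg; exact: UA].
apply: (@diff_class_ext _ _ _ _ (fun x => \sum_(j < n)
   ('D_v f x) 0 j *: ((fun y => 'D_(delta_mx 0 j) g y) \o f) x)) => //.
  move=> x Ux; have dfx := df _ Ux; have dgx := dg _ (UA _ Ux).
  rewrite [RHS]deriveE; last exact: differentiable_comp.
  rewrite diff_comp //= -(deriveE v dfx) [in RHS](row_sum_delta ('D_v f x)).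
  rewrite linear_sum; apply: eq_bigr => j _.
  by rewrite (deriveE _ dgx) -linearZ.
apply: diff_class_sum => // j; apply: diff_class_coordZ => //.
  exact: Df.
exact: IH (diff_classW Hf) (Dg (delta_mx 0 j)).
Qed.

End Smooth.

Section Manifold.
Variable R : realType.

(* The dimension belongs to the chart, so it may vary between components. *)
Record chart (M : topologicalType) := Chart {
  chart_dim : nat;
  chart_dom : set M;
  chart_map : M -> 'rV[R]_chart_dim;
  chart_inv : 'rV[R]_chart_dim -> M;
  chart_dom_open : open chart_dom;
  chart_img_open : open (chart_map @` chart_dom);
  chart_mapK : forall x, chart_dom x -> chart_inv (chart_map x) = x;
  chart_map_continuous :
    forall x, chart_dom x -> {for x, continuous chart_map};
  chart_inv_continuous :
    forall y, (chart_map @` chart_dom) y -> {for y, continuous chart_inv} }.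

Arguments chart_inv {M} c _.

Record manifold := Manifold {
  carrier :> topologicalType;
  atlas : set (chart carrier);
  atlas_cover : forall x, exists2 c, atlas c & chart_dom c x;
  atlas_compatible : forall c d, atlas c -> atlas d ->
    smooth (chart_map c @` (chart_dom c `&` chart_dom d))
           (chart_map d \o chart_inv c);
  manifold_hausdorff : hausdorff_space carrier;
  manifold_second_countable : @second_countable carrier }.

Definition smooth_fun (M : manifold) n (A : set M) (f : M -> 'rV[R]_n) : Prop :=
  forall c, atlas c ->
    smooth (chart_map c @` (chart_dom c `&` A)) (f \o chart_inv c).

Definition smooth_map (M N : manifold) (f : M -> N) : Prop :=
  continuous f /\
  forall d, atlas d -> smooth_fun (f @^-1` chart_dom d) (chart_map d \o f).

Definition submersion (M N : manifold) (f : M -> N) : Prop :=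
  smooth_map f /\
  forall x c d, atlas c -> atlas d -> chart_dom c x -> chart_dom d (f x) ->
    forall w, exists v,
      'd (chart_map d \o f \o chart_inv c) (chart_map c x) v = w.

(* The smooth maps p : U -> M, for U open in some R^k (the values of p outside
   U are irrelevant). *)
Definition plot (M : manifold) k (U : set 'rV[R]_k) (p : 'rV[R]_k -> M) : Prop :=
  (forall u, U u -> {for u, continuous p}) /\
  forall c, atlas c -> smooth (U `&` p @^-1` chart_dom c) (chart_map c \o p).

Lemma plot_open (M : manifold) k (U : set 'rV[R]_k) (p : 'rV[R]_k -> M) A :
  open U -> plot U p -> open A -> open (U `&` p @^-1` A).
Proof.
move=> oU [cp _] oA; rewrite openE => u [Uu Au]; apply: filterI.
  exact: open_nbhs_nbhs.
by apply: (cp u Uu); apply: open_nbhs_nbhs.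
Qed.

Lemma chart_img_sub_open (M : manifold) (c : chart M) (A : set M) :
  open A -> open (chart_map c @` (chart_dom c `&` A)).
Proof.
move=> oA.
have -> : chart_map c @` (chart_dom c `&` A) =
    (chart_map c @` chart_dom c) `&` chart_inv c @^-1` A.
  apply/seteqP; split=> [_ [x [cx Ax] <-]|_ [[x cx <-]]] /=.
    by rewrite chart_mapK //; split=> //; exists x.
  by rewrite chart_mapK // => Ax; exists x.
rewrite openE => y [yc Ay]; apply: filterI.
  by apply: open_nbhs_nbhs; split=> //; exact: chart_img_open.
by apply: (chart_inv_continuous yc); apply: open_nbhs_nbhs.
Qed.

Lemma chart_inv_plot (M : manifold) (c : chart M) (A : set M) : atlas c ->
  plot (chart_map c @` (chart_dom c `&` A)) (chart_inv c).
Proof.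
move=> ac; split=> [y [x [cx _] <-]|d ad].
  by apply: chart_inv_continuous; exists x.
move=> k; apply: diff_class_sub (atlas_compatible ac ad k).
move=> y [[x [cx _] <-]] /=; rewrite chart_mapK // => dx; by exists x.
Qed.

Lemma smooth_fun_plot (M : manifold) n (A : set M) (f : M -> 'rV[R]_n) k
    (U : set 'rV[R]_k) (p : 'rV[R]_k -> M) :
  smooth_fun A f -> open U -> plot U p -> (forall u, U u -> A (p u)) ->
  smooth U (f \o p).
Proof.
move=> sf oU pp UA r; apply: diff_class_cover => u Uu.
have [c ac cu] := atlas_cover (p u).
exists (U `&` p @^-1` chart_dom c) => //.
have oW : open (U `&` p @^-1` chart_dom c).
  by apply: plot_open => //; exact: chart_dom_open.
apply: (@diff_class_ext _ _ _ _ _ ((f \o chart_inv c) \o (chart_map c \o p))) => //.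
  by move=> w [_ cw] /=; rewrite chart_mapK.
apply: diff_class_comp (oW) _ (pp.2 c ac r) (sf c ac r) => w [Uw cw] /=.
by exists (p w) => //; split=> //; exact: UA.
Qed.

Lemma smooth_map_plot (M N : manifold) (f : M -> N) k (U : set 'rV[R]_k)
    (p : 'rV[R]_k -> M) :
  smooth_map f -> open U -> plot U p -> plot U (f \o p).
Proof.
move=> [cf sf] oU pp; split=> [u Uu|d ad].
  by apply: continuous_comp; [exact: pp.1|exact: cf].
rewrite -[chart_map d \o (f \o p)]/((chart_map d \o f) \o p).
have oV : open (U `&` p @^-1` (f @^-1` chart_dom d)).
  apply: plot_open => //; apply: open_comp; last exact: chart_dom_open.
  by move=> x _; exact: cf.
apply: smooth_fun_plot (sf d ad) oV _ _; last by move=> u [].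
split=> [u [Uu _]|c ac r]; first exact: pp.1.
by apply: diff_class_sub (pp.2 c ac r) => u [[]].
Qed.

Lemma smooth_fun_comp (M N : manifold) (f : M -> N) n (A : set N)
    (h : N -> 'rV[R]_n) :
  smooth_map f -> open A -> smooth_fun A h -> smooth_fun (f @^-1` A) (h \o f).
Proof.
move=> sf oA sh c ac.
rewrite -[(h \o f) \o chart_inv c]/(h \o (f \o chart_inv c)).
have oW : open (chart_map c @` (chart_dom c `&` f @^-1` A)).
  apply: chart_img_sub_open; apply: open_comp => // x _; exact: sf.1.
apply: smooth_fun_plot sh (oW) _ _.
  exact: smooth_map_plot sf oW (chart_inv_plot _ ac).
by move=> _ [x [cx Ax] <-] /=; rewrite chart_mapK.
Qed.

End Manifold.

Arguments chart_inv {R M} c _.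

Section VectorBundle.
Variable R : realType.

(* A vector bundle is given by its fibres and an atlas of local
   trivialisations, which are fibrewise linear isomorphisms with smooth
   transition functions. *)
Record vbundle (M : manifold R) := VBundle {
  fibre :> M -> lmodType R;
  triv_index : Type;
  triv_dom : triv_index -> set M;
  triv_rank : triv_index -> nat;
  triv : forall a x, {linear fibre x -> 'rV[R]_(triv_rank a)};
  triv_inv : forall a x, 'rV[R]_(triv_rank a) -> fibre x;
  triv_dom_open : forall a, open (triv_dom a);
  triv_cover : forall x, exists a, triv_dom a x;
  trivK : forall a x, triv_dom a x -> cancel (triv a x) (@triv_inv a x);
  triv_invK : forall a x, triv_dom a x -> cancel (@triv_inv a x) (triv a x);
  triv_smooth : forall a b (w : 'rV[R]_(triv_rank a)),
    smooth_fun (triv_dom a `&` triv_dom b)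
               (fun x => triv b x (@triv_inv a x w)) }.

Arguments triv {M} E a x : rename.
Arguments triv_inv {M} E a x _ : rename.

Section transport.
Variables (M : manifold R) (E : vbundle M).

Definition transport (x y : M) (e : x = y) : E x -> E y :=
  fun v => eq_rect x (fun z => E z : Type) v y e.

Lemma transportD x y (e : x = y) (v w : E x) :
  transport e (v + w) = transport e v + transport e w.
Proof. by case: y / e. Qed.

Lemma transportZ x y (e : x = y) a (v : E x) :
  transport e (a *: v) = a *: transport e v.
Proof. by case: y / e. Qed.

End transport.

Definition graded_vbundle (M : manifold R) := int -> vbundle M.

Definition bounded_grading (M : manifold R) (E : graded_vbundle M) : Prop :=
  exists a b : int, forall n, (n < a) || (b < n) ->
    forall x (v : E n x), v = 0.

Section pullback.
Variables (M N : manifold R) (f : M -> N) (sf : smooth_map f).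

Lemma pullback_triv_smooth (E : vbundle N) (a b : triv_index E)
    (w : 'rV[R]_(triv_rank a)) :
  smooth_fun (f @^-1` triv_dom a `&` f @^-1` triv_dom b)
             (fun x => triv E b (f x) (triv_inv E a (f x) w)).
Proof.
apply: (smooth_fun_comp sf _ (@triv_smooth N E a b w)).
by apply: openI; exact: triv_dom_open.
Qed.

Definition vbundle_pullback (E : vbundle N) : vbundle M :=
  @VBundle M (fun x => E (f x)) (triv_index E)
    (fun a => f @^-1` triv_dom a) (@triv_rank N E)
    (fun a x => triv E a (f x)) (fun a x => triv_inv E a (f x))
    (fun a => open_comp (fun x _ => sf.1 x) (triv_dom_open a))
    (fun x => triv_cover E (f x))
    (fun a x => @trivK N E a (f x)) (fun a x => @triv_invK N E a (f x))
    (@pullback_triv_smooth E).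

End pullback.

End VectorBundle.

Arguments triv {R M} E a x : rename.
Arguments triv_inv {R M} E a x _ : rename.
Arguments transport {R M} E {x y} e v.

Section LieGroupoid.
Variable R : realType.

(* [mul b a] is the composite of z <-b- y <-a- x; its value is irrelevant unless
   [src b = tgt a]. As src and tgt are submersions, the composable pairs form an
   embedded submanifold of the product of two copies of [arrows], and smooth
   maps from an open subset U of some R^k into it are pairs of smooth maps from
   U into [arrows]. So [mul_smooth] says that the multiplication is smooth on
   that submanifold. *)
Record lie_groupoid := LieGroupoid {
  objects : manifold R;
  arrows : manifold R;
  src : arrows -> objects;
  tgt : arrows -> objects;
  unit_arrow : objects -> arrows;
  inv : arrows -> arrows;
  mul : arrows -> arrows -> arrows;
  src_submersion : submersion src;
  tgt_submersion : submersion tgt;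
  unit_smooth : smooth_map unit_arrow;
  inv_smooth : smooth_map inv;
  mul_smooth : forall k (U : set 'rV[R]_k) (b a : 'rV[R]_k -> arrows),
    open U -> plot U b -> plot U a -> (forall u, U u -> src (b u) = tgt (a u)) ->
    plot U (fun u => mul (b u) (a u));
  src_unit : forall x, src (unit_arrow x) = x;
  tgt_unit : forall x, tgt (unit_arrow x) = x;
  src_inv : forall a, src (inv a) = tgt a;
  tgt_inv : forall a, tgt (inv a) = src a;
  src_mul : forall b a, src b = tgt a -> src (mul b a) = src a;
  tgt_mul : forall b a, src b = tgt a -> tgt (mul b a) = tgt b;
  mul_assoc : forall c b a, src c = tgt b -> src b = tgt a ->
    mul c (mul b a) = mul (mul c b) a;
  mul_unitl : forall a, mul (unit_arrow (tgt a)) a = a;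
  mul_unitr : forall a, mul a (unit_arrow (src a)) = a;
  mul_invl : forall a, mul (inv a) a = unit_arrow (src a);
  mul_invr : forall a, mul a (inv a) = unit_arrow (tgt a) }.

Record groupoid_morphism (G' G : lie_groupoid) := GroupoidMorphism {
  on_objects : objects G' -> objects G;
  on_arrows : arrows G' -> arrows G;
  on_objects_smooth : smooth_map on_objects;
  on_arrows_smooth : smooth_map on_arrows;
  morphism_src : forall a, src (on_arrows a) = on_objects (src a);
  morphism_tgt : forall a, tgt (on_arrows a) = on_objects (tgt a);
  morphism_unit : forall x,
    on_arrows (unit_arrow x) = unit_arrow (on_objects x);
  morphism_mul : forall b a, src b = tgt a ->
    on_arrows (mul b a) = mul (on_arrows b) (on_arrows a) }.

Record hypercover_fp (G' G : lie_groupoid) (phi : groupoid_morphism G' G) :=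
  HypercoverFP {
    fp_tgt : objects G';
    fp_src : objects G';
    fp_arrow : arrows G;
    fp_tgtP : on_objects phi fp_tgt = tgt fp_arrow;
    fp_srcP : on_objects phi fp_src = src fp_arrow }.

Definition hypercover_fp_map (G' G : lie_groupoid)
    (phi : groupoid_morphism G' G) (a : arrows G') : hypercover_fp phi :=
  HypercoverFP (esym (morphism_tgt phi a)) (esym (morphism_src phi a)).

(* When phi_0 is a submersion [hypercover_fp phi], the fibre product of
   G'_0 x G'_0 and G_1 over G_0 x G_0, is an embedded submanifold of
   G'_0 x G'_0 x G_1. Hence a map h from it is smooth iff h \o p is smooth for
   all maps p from an open subset of some R^k to the fibre product that have
   smooth components. The map [hypercover_fp_map phi] itself is smooth, since
   its components are. *)
Definition hypercover (G' G : lie_groupoid) (phi : groupoid_morphism G' G) : Prop :=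
  [/\ submersion (on_objects phi),
      forall x, exists x', on_objects phi x' = x &
      exists h : hypercover_fp phi -> arrows G',
        [/\ cancel (hypercover_fp_map phi) h,
            cancel h (hypercover_fp_map phi) &
            forall k (U : set 'rV[R]_k) (p : 'rV[R]_k -> hypercover_fp phi),
              open U -> plot U (@fp_tgt _ _ _ \o p) ->
              plot U (@fp_src _ _ _ \o p) ->
              plot U (@fp_arrow _ _ _ \o p) -> plot U (h \o p)]].

End LieGroupoid.

Record order_map (p n : nat) := OrderMap {
  order_fun :> 'I_p.+1 -> 'I_n.+1;
  order_funP : forall i j : 'I_p.+1, (i <= j)%N ->
    (order_fun i <= order_fun j)%N }.

Section OrderMaps.

Lemma delta_map_subproof n (i : 'I_n.+2) (j k : 'I_n.+1) :
  (j <= k)%N -> (lift i j <= lift i k)%N.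
Proof. by rewrite /= leq_bump2. Qed.

Definition delta_map n (i : 'I_n.+2) : order_map n n.+1 :=
  OrderMap (@delta_map_subproof n i).

Definition iota_map p n (h : (p <= n)%N) : order_map p n :=
  @OrderMap p n (widen_ord (h : (p.+1 <= n.+1)%N)) (fun i j => id).

Lemma tau_map_ltn q n (h : (q <= n)%N) (i : 'I_q.+1) : (n - q + i < n.+1)%N.
Proof. by rewrite ltnS -[leqRHS](subnK h) leq_add2l -ltnS. Qed.

Lemma tau_map_subproof q n (h : (q <= n)%N) (i j : 'I_q.+1) :
  (i <= j)%N -> (Ordinal (tau_map_ltn h i) <= Ordinal (tau_map_ltn h j))%N.
Proof. by rewrite /= leq_add2l. Qed.

Definition tau_map q n (h : (q <= n)%N) : order_map q n :=
  OrderMap (@tau_map_subproof q n h).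

End OrderMaps.

Section Nerve.
Variables (R : realType) (G : lie_groupoid R).

Definition chain_axiom n (obj : 'I_n.+1 -> objects G)
    (arr : forall i j : 'I_n.+1, (i <= j)%N -> arrows G) : Prop :=
  [/\ forall (i j : 'I_n.+1) (h : (i <= j)%N),
        src (arr i j h) = obj i /\ tgt (arr i j h) = obj j,
      forall (i : 'I_n.+1) (h : (i <= i)%N), arr i i h = unit_arrow (obj i) &
      forall (i j k : 'I_n.+1) (hij : (i <= j)%N) (hjk : (j <= k)%N)
          (hik : (i <= k)%N),
        arr i k hik = mul (arr j k hjk) (arr i j hij)].

(* A chain x_n <-g_n- ... <-g_1- x_0 is stored together with all the composites
   [arr i j _] of g_(i+1), ..., g_j from x_i to x_j, i.e. as a functor from
   [n] = {0 <= ... <= n} to G. *)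
Record chain (n : nat) := Chain {
  obj : 'I_n.+1 -> objects G;
  arr : forall i j : 'I_n.+1, (i <= j)%N -> arrows G;
  chainP : chain_axiom obj arr }.

Definition chain_src n (g : chain n) := obj g ord0.
Definition chain_tgt n (g : chain n) := obj g ord_max.

Lemma subchain_subproof p n (g : chain n) (theta : order_map p n) :
  chain_axiom (fun i => obj g (theta i))
    (fun i j h => arr g (order_funP theta h)).
Proof.
by have [ends unit comp] := chainP g; split=> *; [exact: ends|exact: unit|
  exact: comp].
Qed.

Definition subchain p n (g : chain n) (theta : order_map p n) : chain p :=
  Chain (subchain_subproof g theta).

Definition degenerate n (g : chain n) : Prop :=
  exists (i j : 'I_n.+1) (h : (i <= j)%N) (x : objects G),
    j = i.+1 :> nat /\ arr g h = unit_arrow x.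

(* The smooth maps from an open subset U of some R^k to the manifold of chains.
   The latter is embedded in the product of n copies of [arrows] (for n > 0), on
   which the objects and composites of a chain are smooth. *)
Definition chain_plot n k (U : set 'rV[R]_k) (p : 'rV[R]_k -> chain n) : Prop :=
  (forall i, plot U (fun u => obj (p u) i)) /\
  (forall (i j : 'I_n.+1) (h : (i <= j)%N), plot U (fun u => arr (p u) h)).

Lemma chain_src_iota p n (h : (p <= n)%N) (g : chain n) :
  chain_src (subchain g (iota_map h)) = chain_src g.
Proof. by congr (obj g _); exact/val_inj. Qed.

Lemma chain_tgt_tau q n (h : (q <= n)%N) (g : chain n) :
  chain_tgt (subchain g (tau_map h)) = chain_tgt g.
Proof. by congr (obj g _); apply/val_inj => /=; rewrite subnK. Qed.

Lemma chain_cut p q n (hp : (p <= n)%N) (hq : (q <= n)%N) (g : chain n) :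
  (p + q)%N = n ->
  chain_tgt (subchain g (iota_map hp)) = chain_src (subchain g (tau_map hq)).
Proof.
by move=> e; congr (obj g _); apply/val_inj => /=; rewrite -e addnK addn0.
Qed.

Lemma chain_src_delta n (i : 'I_n.+2) (g : chain n.+1) : (0 < i)%N ->
  chain_src (subchain g (delta_map i)) = chain_src g.
Proof.
by move=> i0; congr (obj g _); apply/val_inj; rewrite /= /bump leqNgt i0.
Qed.

Lemma chain_tgt_delta n (i : 'I_n.+2) (g : chain n.+1) : (i < n.+1)%N ->
  chain_tgt (subchain g (delta_map i)) = chain_tgt g.
Proof.
by move=> iN; congr (obj g _); apply/val_inj; rewrite /= /bump -ltnS iN.
Qed.

Lemma degenerate1_src_tgt (g : chain 1) :
  degenerate g -> chain_src g = chain_tgt g.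
Proof.
move=> [i [j [h [x [ij e]]]]].
have [ends _ _] := chainP g; have [] := ends i j h.
have i0 : i = ord0.
  by apply/val_inj => /=; move: (ltn_ord j); rewrite ij !ltnS leqn0 => /eqP.
have j1 : j = ord_max by apply/val_inj; rewrite /= ij i0.
rewrite /chain_src /chain_tgt -i0 -j1 e src_unit tgt_unit => sx tx.
by rewrite -sx -tx.
Qed.

End Nerve.

Arguments chain {R} G n.

Section Ruth.
Variables (R : realType) (G : lie_groupoid R).
Variable E : graded_vbundle (objects G).

(* [rho m g n n'] is the component E_n^{s(g)} -> E_n'^{t(g)} of the linear map
   R_m^g, which vanishes unless n' = n + m - 1. *)
Definition ruth_operators : Type :=
  forall m (g : chain G m) (n n' : int),
    {linear E n (chain_src g) -> E n' (chain_tgt g)}.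

Definition ruth_degree (rho : ruth_operators) : Prop :=
  forall m (g : chain G m) (n n' : int), n' != n + m%:Z - 1 ->
    forall v, rho m g n n' v = 0.

Definition ruth_smooth (rho : ruth_operators) : Prop :=
  forall m (n n' : int) k (U : set 'rV[R]_k) (p : 'rV[R]_k -> chain G m),
    open U -> chain_plot U p ->
    forall (a : triv_index (E n)) (b : triv_index (E n')),
    (forall u, U u -> triv_dom a (chain_src (p u))) ->
    (forall u, U u -> triv_dom b (chain_tgt (p u))) ->
    forall w : 'rV[R]_(triv_rank a),
    smooth U (fun u => triv (E n') b (chain_tgt (p u))
      (rho m (p u) n n' (triv_inv (E n) a (chain_src (p u)) w))).

Definition ruth_RH1 (rho : ruth_operators) : Prop :=
  (forall (g : chain G 1) (deg : degenerate g) (n : int) v,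
     rho 1 g n n v = transport (E n) (degenerate1_src_tgt deg) v) /\
  (forall m (g : chain G m), (2 <= m)%N -> degenerate g ->
     forall n n' v, rho m g n n' v = 0).

Definition inner_vertex m (k : 'I_m.+1) : 'I_m.+3 :=
  lift ord0 (widen_ord (leqnSn m.+1) k).

Lemma inner_vertex_gt0 m (k : 'I_m.+1) : (0 < inner_vertex k)%N.
Proof. by []. Qed.

Lemma inner_vertex_lt m (k : 'I_m.+1) : (inner_vertex k < m.+2)%N.
Proof. by rewrite /= /bump /= add1n ltnS. Qed.

(* The sum over 1 <= k <= m - 1 in (RH2); [inner_vertex k] is k + 1. *)
Definition ruth_inner_faces (rho : ruth_operators) m : forall (g : chain G m)
    (n n' : int), E n (chain_src g) -> E n' (chain_tgt g) :=
  match m with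
  | m'.+2 => fun g n n' v => \sum_(k < m'.+1)
      (-1) ^+ inner_vertex k *:
      transport (E n') (chain_tgt_delta g (inner_vertex_lt k))
        (rho m'.+1 (subchain g (delta_map (inner_vertex k))) n n'
          (transport (E n) (esym (chain_src_delta g (inner_vertex_gt0 k))) v))
  | _ => fun _ _ _ _ => 0
  end.

Definition ruth_composites (rho : ruth_operators) m (g : chain G m) (n : int)
    (v : E n (chain_src g)) : E (n + m%:Z - 2) (chain_tgt g) :=
  \sum_(k < m.+1) (-1) ^+ k *:
    transport (E (n + m%:Z - 2)) (chain_tgt_tau (leq_subr k m) g)
      (rho (m - k)%N (subchain g (tau_map (leq_subr k m)))
           (n + k%:Z - 1) (n + m%:Z - 2)
        (transport (E (n + k%:Z - 1))
          (chain_cut (leq_ord k) (leq_subr k m) g (subnKC (leq_ord k)))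
          (rho k (subchain g (iota_map (leq_ord k))) n (n + k%:Z - 1)
            (transport (E n) (esym (chain_src_iota (leq_ord k) g)) v)))).

Definition ruth_RH2 (rho : ruth_operators) : Prop :=
  forall m (g : chain G m) (n : int) (v : E n (chain_src g)),
    ruth_inner_faces rho (n + m%:Z - 2) v = ruth_composites rho v.

Record ruth := Ruth {
  ruth_op : ruth_operators;
  ruth_opP : [/\ ruth_degree ruth_op, ruth_smooth ruth_op,
                 ruth_RH1 ruth_op & ruth_RH2 ruth_op] }.

Arguments ruth_op : clear implicits.

(* Families of set-theoretic sections of t^*E_{-j} over G_i; smoothness and the
   total degree are imposed by [is_cochain]. *)
Definition cochains : Type :=
  forall (i : nat) (j : int) (g : chain G i), E (- j) (chain_tgt g).

HB.instance Definition _ := gen_eqMixin cochains.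
HB.instance Definition _ := gen_choiceMixin cochains.

Lemma cochainsP (c d : cochains) : (forall i j g, c i j g = d i j g) -> c = d.
Proof. by move=> cd; do 3 (apply: functional_extensionality_dep => ?). Qed.

Let cochains0 : cochains := fun i j g => 0.
Let cochainsN (c : cochains) : cochains := fun i j g => - c i j g.
Let cochainsD (c d : cochains) : cochains := fun i j g => c i j g + d i j g.
Let cochainsZ (a : R) (c : cochains) : cochains := fun i j g => a *: c i j g.

Let cochainsDA : associative cochainsD.
Proof. by move=> x y z; apply: cochainsP => i j g; exact: addrA. Qed.
Let cochainsDC : commutative cochainsD.
Proof. by move=> x y; apply: cochainsP => i j g; exact: addrC. Qed.
Let cochains0D : left_id cochains0 cochainsD.
Proof. by move=> x; apply: cochainsP => i j g; exact: add0r. Qed.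
Let cochainsND : left_inverse cochains0 cochainsN cochainsD.
Proof. by move=> x; apply: cochainsP => i j g; exact: addNr. Qed.

HB.instance Definition _ := GRing.isZmodule.Build cochains
  cochainsDA cochainsDC cochains0D cochainsND.

Let cochainsZA a b (c : cochains) :
  cochainsZ a (cochainsZ b c) = cochainsZ (a * b) c.
Proof. by apply: cochainsP => i j g; exact: scalerA. Qed.
Let cochains1Z : left_id 1 cochainsZ.
Proof. by move=> c; apply: cochainsP => i j g; exact: scale1r. Qed.
Let cochainsZDr : right_distributive cochainsZ +%R.
Proof. by move=> a c d; apply: cochainsP => i j g; exact: scalerDr. Qed.
Let cochainsZDl (c : cochains) : {morph cochainsZ^~ c : a b / a + b}.
Proof. by move=> a b; apply: cochainsP => i j g; exact: scalerDl. Qed.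

HB.instance Definition _ := GRing.Zmodule_isLmodule.Build R cochains
  cochainsZA cochains1Z cochainsZDr cochainsZDl.

Definition smooth_section i j
    (c : forall g : chain G i, E (- j) (chain_tgt g)) : Prop :=
  forall k (U : set 'rV[R]_k) (p : 'rV[R]_k -> chain G i),
    open U -> chain_plot U p ->
    forall a : triv_index (E (- j)),
    (forall u, U u -> triv_dom a (chain_tgt (p u))) ->
    smooth U (fun u => triv (E (- j)) a (chain_tgt (p u)) (c (p u))).

(* C^n(G, E) is the direct sum of the C^{i,j}(G, E) over i + j = n. *)
Definition is_cochain (n : int) (c : cochains) : Prop :=
  [/\ forall i j, smooth_section (c i j),
      forall i j, i%:Z + j != n -> forall g, c i j g = 0 &
      exists N : nat, forall i j, (N <= i)%N -> forall g, c i j g = 0].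

Section differential.
Variable rho : ruth.

(* The term (-1)^j R_m^{g tau_m} c(g iota_i) of d_m(c) on G_k, with k = i + m,
   for m <= k and the component of c in C^{i,j}, where E_{-j'} with
   j' = j - m + 1 contains the values of d_m(c). *)
Definition coboundary_op m k (h : (m <= k)%N) (c : cochains) (j' : int)
    (g : chain G k) : E (- j') (chain_tgt g) :=
  let i := (k - m)%N in
  let j := j' + m%:Z - 1 in
  (-1 : R) ^ j *:
    transport (E (- j')) (chain_tgt_tau h g)
      (ruth_op rho m (subchain g (tau_map h)) (- j) (- j')
        (transport (E (- j))
          (chain_cut (leq_subr m k) h g (subnK h))
          (c i j (subchain g (iota_map (leq_subr m k)))))).

Lemma outer_vertex_lt i (r : 'I_i.+1) :
  (widen_ord (leqnSn i.+1) r < i.+1)%N.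
Proof. exact: (ltn_ord r). Qed.

Definition coboundary_faces k (c : cochains) (j : int) :
    forall g : chain G k, E (- j) (chain_tgt g) :=
  match k with
  | i.+1 => fun g =>
      (-1 : R) ^ (i%:Z + j + 1) *: \sum_(r < i.+1) (-1) ^+ r *:
        transport (E (- j)) (chain_tgt_delta g (outer_vertex_lt r))
          (c i j (subchain g (delta_map (widen_ord (leqnSn i.+1) r))))
  | 0 => fun=> 0
  end.

(* The component of d(c) on G_k is the sum of those of d_0(c), ..., d_k(c);
   [coboundary_op] gives the first term of d_1(c) too, as d_{i+1} g = g iota_i
   for g in G_{i+1}, and [coboundary_faces] its second term. *)
Definition coboundary (c : cochains) : cochains := fun k j g =>
  (\sum_(m < k.+1) coboundary_op (leq_ord m) c j g) + coboundary_faces c j g.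

Lemma coboundary_op_linear m k (h : (m <= k)%N) a (c d : cochains) j g :
  @coboundary_op m k h (a *: c + d) j g =
  a *: coboundary_op h c j g + coboundary_op h d j g.
Proof.
rewrite /coboundary_op scalerA mulrC -scalerA -scalerDr; congr (_ *: _).
by rewrite transportD transportZ linearP transportD transportZ.
Qed.

Lemma coboundary_faces_linear k a (c d : cochains) j (g : chain G k) :
  coboundary_faces (a *: c + d) j g =
  a *: coboundary_faces c j g + coboundary_faces d j g.
Proof.
case: k g => [|i] g /=; first by rewrite scaler0 addr0.
rewrite scalerA mulrC -scalerA -scalerDr; congr (_ *: _).
rewrite scaler_sumr -big_split; apply: eq_bigr => r _ /=.
rewrite scalerA mulrC -scalerA -scalerDr; congr (_ *: _).
by rewrite transportD transportZ.
Qed.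

Lemma coboundary_linear : linear coboundary.
Proof.
move=> a c d; apply: cochainsP => k j g.
rewrite /coboundary coboundary_faces_linear.
under eq_bigr do rewrite coboundary_op_linear.
by rewrite big_split /= -scaler_sumr addrACA -scalerDr.
Qed.

HB.instance Definition _ := GRing.isLinear.Build R cochains cochains _
  coboundary coboundary_linear.

End differential.

End Ruth.

Arguments ruth_op {R G E} r m g n n'.

Section Cohomology.
Variables (R : realType) (G : lie_groupoid R).
Variables (E : graded_vbundle (objects G)) (rho : ruth E) (n : int).

Lemma smooth_sectionD i j a (c d : forall g : chain G i, E (- j) (chain_tgt g)) :
  smooth_section c -> smooth_section d ->
  smooth_section (fun g => a *: c g + d g).
Proof.
move=> sc sd k U p oU pp b bU r.
apply: (@diff_class_ext _ _ _ _ _ (fun u =>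
  a *: triv (E (- j)) b (chain_tgt (p u)) (c (p u)) +
  triv (E (- j)) b (chain_tgt (p u)) (d (p u)))) => //.
  by move=> u _; rewrite linearP.
apply: diff_classD => //; last exact: sd.
by apply: diff_classZ => //; exact: sc.
Qed.

Lemma smooth_section0 i j :
  smooth_section (fun g : chain G i => 0 : E (- j) (chain_tgt g)).
Proof.
move=> k U p oU pp b bU r; apply: (@diff_class_ext _ _ _ _ _ (fun=> 0)) => //.
  by move=> u _; rewrite linear0.
exact: diff_class_cst.
Qed.

Lemma is_cochain0 m : is_cochain m (0 : cochains E).
Proof. by split=> // [i j|]; [exact: smooth_section0|exists 0%N]. Qed.

Lemma is_cochainP m a (c d : cochains E) :
  is_cochain m c -> is_cochain m d -> is_cochain m (a *: c + d).
Proof.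
move=> [sc cm [N cN]] [sd dm [N' dN]]; split=> [i j|i j ij g|].
- exact: smooth_sectionD.
- by rewrite -[LHS]/(a *: c i j g + d i j g) cm // dm // scaler0 addr0.
- exists (maxn N N') => i j; rewrite geq_max => /andP[Ni N'i] g.
  by rewrite -[LHS]/(a *: c i j g + d i j g) cN // dN // scaler0 addr0.
Qed.

Definition is_cocycle : {pred cochains E} :=
  fun c => `[< is_cochain n c /\ coboundary rho c = 0 >].

Lemma is_cocycle_submod : subsemimod_closed is_cocycle.
Proof.
apply: GRing.submod_closed_semi; split.
  by apply/asboolP; split; [exact: is_cochain0|rewrite linear0].
move=> a c d /asboolP[sc dc] /asboolP[sd dd]; apply/asboolP; split.
  exact: is_cochainP.
by rewrite coboundary_linear dc dd scaler0 addr0.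
Qed.

HB.instance Definition _ :=
  GRing.isSubmodClosed.Build R (cochains E) is_cocycle is_cocycle_submod.

Record cocycle := Cocycle { cocycle_val :> cochains E; _ : is_cocycle cocycle_val }.

HB.instance Definition _ := [isSub for cocycle_val].
HB.instance Definition _ := [Choice of cocycle by <:].
HB.instance Definition _ := [SubChoice_isSubLmodule of cocycle by <:].

Definition is_exact : {pred cocycle} :=
  fun z => `[< exists2 b, is_cochain (n - 1) b & coboundary rho b = z >].

Lemma is_exact_submod : subsemimod_closed is_exact.
Proof.
apply: GRing.submod_closed_semi; split.
  by apply/asboolP; exists 0; [exact: is_cochain0|rewrite !linear0].
move=> a y z /asboolP[b sb db] /asboolP[c sc dc]; apply/asboolP.
by exists (a *: b + c); [exact: is_cochainP|rewrite coboundary_linear db dc].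
Qed.

HB.instance Definition _ :=
  GRing.isSubmodClosed.Build R cocycle is_exact is_exact_submod.

Definition cohomology : Type := Quotient.quot is_exact.

HB.instance Definition _ := GRing.Zmodule.on cohomology.

Definition cohomology_class (z : cocycle) : cohomology :=
  (\pi_(Quotient.quot is_exact) z)%qT.

Lemma cohomology_classP y z :
  is_exact (y - z) <-> cohomology_class y = cohomology_class z.
Proof.
rewrite -[is_exact _]/(y - z \in is_exact) Quotient.idealrBE.
by split=> [/eqP|e]; last exact/eqP.
Qed.

Lemma cohomology_classD : {morph cohomology_class : y z / y + z}.
Proof. exact: raddfD. Qed.

Definition cohomology_repr (h : cohomology) : cocycle :=
  repr (h : Quotient.quot is_exact).

Lemma cohomology_reprK : cancel cohomology_repr cohomology_class.
Proof. exact: reprK. Qed.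

Definition cohomology_scale (a : R) (h : cohomology) : cohomology :=
  cohomology_class (a *: cohomology_repr h).

Lemma cohomology_classZ a z :
  cohomology_class (a *: z) = cohomology_scale a (cohomology_class z).
Proof.
apply/cohomology_classP; rewrite -scalerBr.
by apply: (@rpredZ _ _ is_exact); apply/cohomology_classP; rewrite cohomology_reprK.
Qed.

Lemma cohomology_scaleA a b h :
  cohomology_scale a (cohomology_scale b h) = cohomology_scale (a * b) h.
Proof. by rewrite -[h]cohomology_reprK -!cohomology_classZ scalerA. Qed.

Lemma cohomology_scale1 : left_id 1 cohomology_scale.
Proof.
by move=> h; rewrite -[h]cohomology_reprK -cohomology_classZ scale1r.
Qed.

Lemma cohomology_scaleDr : right_distributive cohomology_scale +%R.
Proof.
move=> a h h'; rewrite -[h]cohomology_reprK -[h']cohomology_reprK.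
by rewrite -cohomology_classD -!cohomology_classZ scalerDr cohomology_classD.
Qed.

Lemma cohomology_scaleDl h : {morph cohomology_scale^~ h : a b / a + b}.
Proof.
move=> a b; rewrite -[h]cohomology_reprK -!cohomology_classZ -cohomology_classD.
by rewrite scalerDl.
Qed.

HB.instance Definition _ := GRing.Zmodule_isLmodule.Build R cohomology
  cohomology_scaleA cohomology_scale1 cohomology_scaleDr cohomology_scaleDl.

Lemma cohomology_class_linear : linear cohomology_class.
Proof.
move=> a y z; rewrite cohomology_classD; congr (_ + _).
exact: cohomology_classZ.
Qed.

End Cohomology.

Section Pullback.
Variables (R : realType) (G' G : lie_groupoid R) (phi : groupoid_morphism G' G).

Lemma chain_pullback_subproof n (g : chain G' n) :
  chain_axiom (fun i => on_objects phi (obj g i))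
    (fun i j h => on_arrows phi (arr g h)).
Proof.
have [ends unit comp] := chainP g; split=> [i j h|i h|i j k hij hjk hik].
- by rewrite morphism_src morphism_tgt (ends i j h).1 (ends i j h).2.
- by rewrite unit morphism_unit.
- by rewrite (comp _ _ _ hij hjk hik) morphism_mul // (ends _ _ _).1 (ends _ _ _).2.
Qed.

Definition chain_map n (g : chain G' n) : chain G n :=
  Chain (chain_pullback_subproof g).

Lemma chain_map_plot n k (U : set 'rV[R]_k) (p : 'rV[R]_k -> chain G' n) :
  open U -> chain_plot U p -> chain_plot U (@chain_map n \o p).
Proof.
move=> oU [po pa]; split=> [i|i j h].
  exact: smooth_map_plot (on_objects_smooth phi) oU (po i).
exact: smooth_map_plot (on_arrows_smooth phi) oU (pa i j h).
Qed.

Lemma chain_map_degenerate n (g : chain G' n) :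
  degenerate g -> degenerate (chain_map g).
Proof.
move=> [i [j [h [x [ij e]]]]]; exists i, j, h, (on_objects phi x).
by rewrite /= e morphism_unit.
Qed.

Variable E : graded_vbundle (objects G).

Definition graded_pullback : graded_vbundle (objects G') :=
  fun n => vbundle_pullback (on_objects_smooth phi) (E n).

Lemma transport_pullback n x y (e : x = y) (e' : on_objects phi x = on_objects phi y)
    (v : E n (on_objects phi x)) :
  transport (graded_pullback n) e v = transport (E n) e' v.
Proof. by case: y / e e' => e'; rewrite (Prop_irrelevance e' erefl). Qed.

(* [subchain] and [chain_map] commute only up to the proofs in the chains, so
   not up to conversion. *)
Lemma ruth_op_irrelevant (rho : ruth_operators E) n obj arr
    (p q : @chain_axiom R G n obj arr) m m' v :
  rho n (Chain p) m m' v = rho n (Chain q) m m' v.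
Proof. by case: _ / (Prop_irrelevance p q). Qed.

Lemma cochain_irrelevant (c : cochains E) n obj arr
    (p q : @chain_axiom R G n obj arr) j :
  c n j (Chain p) = c n j (Chain q).
Proof. by case: _ / (Prop_irrelevance p q). Qed.

Definition ruth_op_pullback (rho : ruth_operators E) :
    ruth_operators graded_pullback :=
  fun m g n n' => rho m (chain_map g) n n'.

Lemma ruth_op_subchain (rho : ruth_operators E) p q (theta : order_map p q)
    (g : chain G' q) m m' (v : E m (on_objects phi (obj g (theta ord0)))) :
  rho p (subchain (chain_map g) theta) m m' v =
  ruth_op_pullback rho (subchain g theta) m m' v.
Proof. exact: ruth_op_irrelevant. Qed.

Lemma ruth_pullback_subproof (rho : ruth E) :
  let op := ruth_op_pullback (ruth_op rho) in
  [/\ ruth_degree op, ruth_smooth op, ruth_RH1 op & ruth_RH2 op].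
Proof.
have [deg sm [rh1 rh1'] rh2] := ruth_opP rho; split.
- by move=> m g n n' nn' v; exact: (deg m (chain_map g) n n' nn' v).
- move=> m n n' k U p oU pp a b aU bU w.
  exact: (sm m n n' k U _ oU (chain_map_plot oU pp) a b aU bU w).
- split=> [g dg n v|m g m2 dg n n' v].
    rewrite [LHS](rh1 _ (chain_map_degenerate dg)).
    by apply/esym; exact: transport_pullback.
  exact: (rh1' m (chain_map g) m2 (chain_map_degenerate dg) n n' v).
- move=> m g n v; have := rh2 m (chain_map g) n v.
  rewrite /ruth_composites => rh2m.
  transitivity (ruth_inner_faces (ruth_op rho) (n + m%:Z - 2)
    (v : E n (chain_src (chain_map g)))).
    case: m g v {rh2m} => [|[|m]] g v //=; apply: eq_bigr => k _.
    congr (_ *: _); rewrite (transport_pullback _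
      (chain_tgt_delta (chain_map g) (inner_vertex_lt k))).
    rewrite (transport_pullback _
      (esym (chain_src_delta (chain_map g) (inner_vertex_gt0 k)))).
    refine (congr1 (transport _ _) (esym _)); exact: ruth_op_subchain.
  rewrite rh2m; apply: eq_bigr => k _; congr (_ *: _).
  rewrite (transport_pullback _
    (chain_tgt_tau (leq_subr k m) (chain_map g))).
  rewrite (transport_pullback _ (chain_cut (leq_ord k) (leq_subr k m)
    (chain_map g) (subnKC (leq_ord k)))).
  rewrite (transport_pullback _
    (esym (chain_src_iota (leq_ord k) (chain_map g)))).
  refine (congr1 (transport _ _) (etrans _ (ruth_op_subchain (ruth_op rho) _ _))).
  refine (congr1 (ruth_op _ _ _ _ _) (congr1 (transport _ _) _)).
  exact: ruth_op_subchain.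
Qed.

Definition ruth_pullback (rho : ruth E) : ruth graded_pullback :=
  Ruth (ruth_pullback_subproof rho).

Definition cochain_pullback (c : cochains E) : cochains graded_pullback :=
  fun i j g => c i j (chain_map g).

Lemma cochain_subchain (c : cochains E) p q (theta : order_map p q)
    (g : chain G' q) j :
  c p j (subchain (chain_map g) theta) = cochain_pullback c j (subchain g theta).
Proof. exact: cochain_irrelevant. Qed.

Lemma cochain_pullback_linear : linear cochain_pullback.
Proof. by []. Qed.

Lemma cochain_pullback_is_cochain n c :
  is_cochain n c -> is_cochain n (cochain_pullback c).
Proof.
move=> [sc cn [N cN]]; split=> [i j k U p oU pp a aU|i j ij g|].
- exact: (sc i j k U _ oU (chain_map_plot oU pp) a aU).
- exact: (cn i j ij (chain_map g)).
- by exists N => i j Ni g; exact: (cN i j Ni (chain_map g)).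
Qed.

Variables (rho : ruth E) (n : int).

Lemma cochain_pullback_coboundary c :
  coboundary (ruth_pullback rho) (cochain_pullback c) =
  cochain_pullback (coboundary rho c).
Proof.
apply: cochainsP => k j g; rewrite /coboundary /cochain_pullback.
refine (congr2 +%R _ _).
  apply: eq_bigr => m _; rewrite /coboundary_op; refine (congr1 ( *:%R _) _).
  rewrite (transport_pullback _ (chain_tgt_tau (leq_ord m) (chain_map g))).
  rewrite (transport_pullback _ (chain_cut (leq_subr m k) (leq_ord m)
    (chain_map g) (subnK (leq_ord m)))).
  refine (esym (congr1 (transport _ _) (etrans _ (ruth_op_subchain (ruth_op rho) _ _)))).
  refine (congr1 (ruth_op _ _ _ _ _) (congr1 (transport _ _) _)).
  exact: cochain_subchain.
case: k g => [|i] g //=; refine (congr1 ( *:%R _) _).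
apply: eq_bigr => r _; refine (congr1 ( *:%R _) _).
rewrite (transport_pullback _ (chain_tgt_delta (chain_map g) (outer_vertex_lt r))).
refine (congr1 (transport _ _) _).
exact: (esym (cochain_subchain _ _ _ _)).
Qed.

Lemma cochain_pullback_cocycle c :
  is_cocycle rho n c -> is_cocycle (ruth_pullback rho) n (cochain_pullback c).
Proof.
move=> /asboolP[sc dc]; apply/asboolP; split.
  exact: cochain_pullback_is_cochain.
by rewrite cochain_pullback_coboundary dc.
Qed.

Definition cocycle_pullback (z : cocycle rho n) : cocycle (ruth_pullback rho) n :=
  Cocycle (cochain_pullback_cocycle (valP z)).

Lemma cocycle_pullback_linear : linear cocycle_pullback.
Proof. by move=> a y z; exact/val_inj. Qed.

Lemma cocycle_pullback_exact y z :
  is_exact (y - z) -> is_exact (cocycle_pullback y - cocycle_pullback z).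
Proof.
move=> /asboolP[b sb db]; apply/asboolP; exists (cochain_pullback b).
  exact: cochain_pullback_is_cochain.
by rewrite cochain_pullback_coboundary db.
Qed.

Definition cohomology_pullback (h : cohomology rho n) :
    cohomology (ruth_pullback rho) n :=
  cohomology_class (cocycle_pullback (cohomology_repr h)).

Lemma cohomology_pullback_class z :
  cohomology_pullback (cohomology_class z) =
  cohomology_class (cocycle_pullback z).
Proof.
apply/cohomology_classP/cocycle_pullback_exact/cohomology_classP.
exact: cohomology_reprK.
Qed.

Lemma cohomology_pullback_linear : linear cohomology_pullback.
Proof.
move=> a h h'; rewrite -[h]cohomology_reprK -[h']cohomology_reprK.
rewrite -cohomology_class_linear !cohomology_pullback_class.
by rewrite cocycle_pullback_linear cohomology_class_linear.
Qed.

HB.instance Definition _ := GRing.isLinear.Build R (cohomology rho n)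
  (cohomology (ruth_pullback rho) n) _ cohomology_pullback
  cohomology_pullback_linear.

End Pullback.

Arguments ruth_pullback {R G' G} phi {E} rho.
Arguments cohomology_pullback {R G' G} phi {E} rho n h.

(* Main.v *)
(* Let s_k be sections of phi_0, smooth on open sets A_k covering G_0, and (w_k) a
   partition of unity subordinate to (A_k). As G'_1 is the pullback of G_1, a chain
   of G' is a chain of G with a lift of each vertex. So a cochain c of G' descends
   to the cochain of G whose value on a chain x_0, ..., x_n is the mean of c over the
   lifts s_(k_0)(x_0), ..., s_(k_n)(x_n), with weights w_(k_0)(x_0) ... w_(k_n)(x_n).
   As the weights sum to 1 and the operators R_m of the pullback do not see the lifts,
   this commutes with the differentials, and it is a left inverse of phi^*. It is a
   right inverse up to the mean of the prism homotopies, which replace the lifts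
   y_0, ..., y_n by other lifts z_0, ..., z_n one vertex after the other:
     (h c)(g; y, z) = (-1)^(n+j) sum_k (-1)^k c(y_0, ..., y_k, z_k, ..., z_n).
   The edge from y_k to z_k lies over a unit, so d h + h d = c(g; y) - c(g; z) follows
   from (RH1). The sections s_k come from the inverse function theorem. *)

Require Import Defs.
From HB Require Import structures.
From mathcomp Require Import all_boot all_order all_algebra.
From mathcomp Require Import all_classical all_reals all_analysis.
From mathcomp Require Import ring lra zify.
Import Order.TTheory GRing.Theory Num.Theory numFieldNormedType.Exports.
Set Implicit Arguments.
Unset Strict Implicit.
Unset Printing Implicit Defensive.
Local Open Scope classical_set_scope.
Local Open Scope ring_scope.

(** * Smooth functions on open sets *)

Section DiffClass.
Variables (R : realType) (V : normedModType R).
Implicit Types (U : set V) (f g : V -> R).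

Lemma diff_classM k U f g : open U -> diff_class k U f -> diff_class k U g ->
  diff_class k U (fun x => f x * g x).
Proof.
move=> oU; elim: k f g => [|k IH] f g.
  by move=> cf cg x Ux; apply: cvgM; [exact: cf|exact: cg].
move=> Hf Hg; have [df Df] := Hf; have [dg Dg] := Hg; split=> [x Ux|v].
  by apply: differentiableM; [exact: df|exact: dg].
apply: (@diff_class_ext _ _ _ _ _
  (fun x => f x * 'D_v g x + g x * 'D_v f x)) => //.
  move=> x Ux; rewrite -[RHS]/('D_v (f * g) x).
  by rewrite deriveM //; apply: diff_derivable; [exact: df|exact: dg].
apply: diff_classD => //; apply: IH.
- exact: diff_classW Hf.
- exact: Dg.
- exact: diff_classW Hg.
- exact: Df.
Qed.

Lemma diff_class_inv k U f : open U -> (forall x, U x -> f x != 0) ->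
  diff_class k U f -> diff_class k U (fun x => (f x)^-1).
Proof.
move=> oU f0; elim: k => [|k IH].
  by move=> cf x Ux; apply: cvgV; [exact: f0|exact: cf].
move=> Hf; have [df Df] := Hf; split=> [x Ux|v].
  by apply: differentiableV; [exact: df|exact: f0].
apply: (@diff_class_ext _ _ _ _ _
  (fun x => (- 1) * ((f x)^-1 * (f x)^-1) * 'D_v f x)) => //.
  move=> x Ux; rewrite -[RHS]/('D_v (fun y => (f y)^-1) x).
  rewrite deriveV ?f0 //; last exact/diff_derivable/df.
  by rewrite /GRing.scale /= mulN1r expr2 invfM.
apply: diff_classM => //; last exact: Df v.
apply: diff_classM => //; first exact: diff_class_cst.
by apply: diff_classM => //; apply/IH/diff_classW.
Qed.

Lemma diff_class_scale (W : normedModType R) k U f (w : W) :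
  open U -> diff_class k U f -> diff_class k U (fun x => f x *: w).
Proof.
move=> oU; elim: k f => [|k IH] f.
  by move=> cf x Ux; apply: cvgZr_tmp; exact: cf.
move=> [df Df]; split=> [x Ux|v]; first by apply: differentiableZl; exact: df.
apply: (@diff_class_ext _ _ _ _ _ (fun x => 'D_v f x *: w)) => //; last first.
  exact: IH (Df v).
move=> x Ux; rewrite deriveE; last exact/df.
rewrite deriveE; last by apply: differentiableZl; exact: df.
rewrite diffZl //; exact: df.
Qed.

Lemma diff_class_coord n k U (f : V -> 'rV[R]_n) i : open U ->
  diff_class k U f -> diff_class k U (fun x => f x 0 i).
Proof.
move=> oU; elim: k f => [|k IH] f.
  move=> cf x Ux; apply: (@continuous_comp _ _ _ f (fun M : 'rV[R]_n => M 0 i)).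
    exact: cf.
  exact: coord_continuous.
move=> [df Df]; split=> [x Ux|v].
  apply: (@differentiable_comp _ _ _ _ f (fun M : 'rV[R]_n => M 0 i)).
    exact: df.
  exact: differentiable_coord.
apply: (@diff_class_ext _ _ _ _ _ (fun x => ('D_v f x) 0 i)) => //; last first.
  exact: IH (Df v).
by move=> x Ux; rewrite derive_mx ?mxE //; exact/diff_derivable/df.
Qed.

Lemma diff_class_row n k U (f : V -> 'rV[R]_n) : open U ->
  (forall i, diff_class k U (fun x => f x 0 i)) -> diff_class k U f.
Proof.
move=> oU H.
apply: (@diff_class_ext _ _ _ _ _
  (fun x => \sum_(i < n) f x 0 i *: (delta_mx 0 i : 'rV[R]_n))) => //.
  by move=> x _; rewrite [RHS]row_sum_delta.
by apply: diff_class_sum => // i; exact: diff_class_scale.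
Qed.

Lemma diff_class_prod k U (I : Type) (r : seq I) (F : I -> V -> R) : open U ->
  (forall i, diff_class k U (F i)) ->
  diff_class k U (fun x => \prod_(i <- r) F i x).
Proof.
move=> oU H; elim: r => [|i r IH].
  by under eq_fun do rewrite big_nil; exact: diff_class_cst.
by under eq_fun do rewrite big_cons; exact: diff_classM.
Qed.

End DiffClass.

Section Flat.
Variable R : realType.

(* The powers of x^-1 make the family closed under differentiation. *)
Definition flat (n : nat) (x : R) : R :=
  if 0 < x then x^-1 ^+ n * expR (- x^-1) else 0.

Lemma flat_ge0 n x : 0 <= flat n x.
Proof.
rewrite /flat; case: ifP => // x0.
by rewrite mulr_ge0 ?expR_ge0 // exprn_ge0 // invr_ge0 ltW.
Qed.

Lemma flat_gt0 n x : (0 < flat n x) = (0 < x).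
Proof.
rewrite /flat; case: ifPn => [x0|_]; last by rewrite ltxx.
by rewrite mulr_gt0 ?expR_gt0 // exprn_gt0 // invr_gt0.
Qed.

Lemma flat_le n x : `|flat n x| <= (n.+2)`!%:R * `|x| ^+ 2.
Proof.
rewrite ger0_norm ?flat_ge0 // /flat; case: ifPn => [x0|_]; last first.
  by rewrite mulr_ge0 // exprn_ge0.
rewrite gtr0_norm // expRN ler_pdivrMr ?expR_gt0 //.
have xi0 : 0 <= x^-1 by rewrite invr_ge0 ltW.
have := expR_ge1Dxn n.+1 xi0.
have f0 : 0 < (n.+2)`!%:R :> R by rewrite ltr0n fact_gt0.
move=> h; rewrite -ler_pdivrMl ?mulr_gt0 ?exprn_gt0 //.
apply: le_trans h; apply: ler_wpDl => //.
rewrite le_eqVlt; apply/orP; left; apply/eqP.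
by rewrite invfM -exprVn -addn2 exprD; ring.
Qed.

Lemma flat_is_derive n (x : R) :
  is_derive x (1 : R) (flat n) (- n%:R * flat n.+1 x + flat n.+2 x).
Proof.
have [x0|x0|<-] := ltgtP 0 x.
- have x1 : x != 0 by rewrite gt_eqF.
  have H : is_derive x (1:R) (fun y : R => y^-1 ^+ n * expR (- y^-1))
      (- n%:R * flat n.+1 x + flat n.+2 x).
    have iV : is_derive x (1:R) (fun y : R => y^-1) (- x ^- 2).
      have := @is_deriveV _ id x 1 1 x1 _.
      by rewrite /GRing.scale /= mulr1; apply.
    have iE : is_derive x (1 : R) (fun y : R => expR (- y^-1))
        (expR (- x^-1) * - - x ^- 2).
      exact: (@is_derive1_comp _ expR (fun y => - y^-1)).
    have H := is_deriveM (is_deriveX n iV) iE.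
    rewrite (_ : (fun y : R => _) = GRing.inv ^+ n * (fun y => expR (- y^-1))); last first.
      by rewrite exprfctE.
    apply: is_derive_eq H _; rewrite /flat x0 /GRing.scale /=.
    rewrite exprfctE -exprVn opprK.
    by case: (n) => [|m]; rewrite /= ?exprS; ring.
  apply: near_eq_is_derive H; near=> y.
  rewrite /flat ifT //; near: y; exact: lt_nbhsr.
- rewrite /flat !(lt_gtF x0) mulr0 addr0.
  apply: (@near_eq_is_derive _ _ _ (cst 0)).
  near=> y; rewrite ifF //; apply: lt_gtF; near: y; exact: lt_nbhsl.
- rewrite {2 3}/flat ltxx mulr0 addr0.
  have H : h^-1 *: ((flat n \o shift 0) (h *: 1) - flat n 0) @[h --> 0^'] --> (0 : R).
    rewrite {2}/flat ltxx; apply/cvgr0Pnorm_le => e e0.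
    have C0 : 0 < (n.+2)`!%:R :> R by rewrite ltr0n fact_gt0.
    near=> h; rewrite /= subr0 addr0 /GRing.scale /= mulr1 normrM normfV.
    have h0 : 0 < `|h| by rewrite normr_gt0; near: h; exact: nbhs_dnbhs_neq.
    rewrite ler_pdivrMl //; apply: (le_trans (flat_le _ _)).
    rewrite expr2 mulrA mulrC ler_pM2l // mulrC -ler_pdivlMr //.
    near: h; apply: dnbhs0_le; exact: divr_gt0.
  apply: DeriveDef; first by apply: cvgP H.
  exact: cvg_lim H.
Unshelve. all: by end_near. Qed.

Lemma diff_class_flat (V : normedModType R) k (U : set V) (f : V -> R) n :
  open U -> diff_class k U f -> diff_class k U (fun x => flat n (f x)).
Proof.
move=> oU; elim: k n => [|k IH] n.
  move=> cf x Ux; apply: (@continuous_comp _ _ _ f (flat n)); first exact: cf.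
  apply/differentiable_continuous/derivable1_diffP.
  by have [] := flat_is_derive n (f x).
move=> Hf; have [df Df] := Hf.
have dF x : differentiable (flat n) x.
  by apply/derivable1_diffP; have [] := flat_is_derive n x.
split=> [x Ux|v].
  by apply: (@differentiable_comp _ _ _ _ f (flat n)) => //; exact: df.
apply: (@diff_class_ext _ _ _ _ _ (fun x =>
   (- n%:R * flat n.+1 (f x) + flat n.+2 (f x)) * 'D_v f x)) => //.
  move=> x Ux; have dfx := df _ Ux.
  rewrite [RHS]deriveE; last exact: differentiable_comp.
  rewrite (@diff_comp _ _ _ _ f (flat n)) //= -(deriveE v dfx).
  rewrite [X in _ = 'd _ _ X](_ : _ = 'D_v f x *: (1 : R)); last first.
    by rewrite /GRing.scale /= mulr1.
  rewrite linearZ /=.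
  rewrite -deriveE // (@derive_val _ _ _ _ _ _ _ (flat_is_derive n (f x))).
  by rewrite /GRing.scale /= mulrC.
apply: diff_classM => //; last exact: Df v.
apply: diff_classD => //; last exact/IH/diff_classW.
apply: diff_classM => //; first exact: diff_class_cst.
exact/IH/diff_classW.
Qed.

End Flat.

(** * The inverse function theorem *)

Section FrechetEstimate.
Variables (R : realType) (V W : normedModType R).

Lemma differentiable_norm_le (f : V -> W) x (e : R) :
  differentiable f x -> 0 < e ->
  \forall h \near (0 : V), `|f (h + x) - f x - 'd f x h| <= e * `|h|.
Proof.
move=> /diff_locallyP[_ /eqaddoP fo] e0; near=> h.
have : `|(f \o shift x - (cst (f x) + 'd f x)) h| <= e * `|h|.
  by near: h; exact: fo.
by rewrite !fctE /= opprD addrA.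
Unshelve. all: by end_near. Qed.

Lemma norm_le_differentiable (f : V -> W) x (T : {linear V -> W}) :
  continuous T ->
  (forall e : R, 0 < e ->
    \forall h \near (0 : V), `|f (h + x) - f x - T h| <= e * `|h|) ->
  differentiable f x /\ 'd f x = T :> (V -> W).
Proof.
move=> cT H.
have fo : f \o shift x = cst (f x) + T +o_ 0 id.
  apply/eqaddoP => e e0; near=> h.
  rewrite !fctE /= opprD addrA; near: h; exact: H.
have dT := diff_unique cT fo; split=> //.
by apply/diff_locallyP; rewrite dT.
Unshelve. all: by end_near. Qed.

End FrechetEstimate.

Section RowNorm.
Variable R : realType.

Lemma row_norm_le n (x : 'rV[R]_n) (c : R) : 0 <= c ->
  (forall i, `|x 0 i| <= c) -> `|x| <= c.
Proof.
move=> c0 H; rewrite [`|x|]mx_normrE; apply/bigmax_leP; split=> // -[i j] _ /=.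
by rewrite (ord1 i).
Qed.

Lemma row_coord_le n (x : 'rV[R]_n) i : `|x 0 i| <= `|x|.
Proof. by rewrite [`|x|]mx_normrE; apply: (le_bigmax _ _ (0, i)). Qed.

Lemma mulmxr_continuous m n (M : 'M[R]_(m, n)) :
  continuous (fun x : 'rV[R]_m => x *m M).
Proof.
have -> : (fun x : 'rV[R]_m => x *m M) = fun x => \sum_i x 0 i *: row i M.
  by apply/funext => x; rewrite mulmx_sum_row.
move=> x; apply: (@diff_class_sum _ _ _ 0%N setT _ _
  (fun i (y : 'rV[R]_m) => y 0 i *: row i M) openT _ x I) => i.
apply: diff_class_scale; first exact: openT.
by apply: (@diff_class_coord _ _ _ 0%N _ id); [exact: openT|move=> y _].
Qed.

Lemma jacobian_coord m n (f : 'rV[R]_m -> 'rV[R]_n) x i j :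
  differentiable f x -> jacobian f x i j = 'D_(delta_mx 0 i) f x 0 j.
Proof. by move=> df; rewrite deriveEjacobian // -rowE [in RHS]mxE. Qed.

End RowNorm.

Section DiffClassMatrix.
Variables (R : realType) (V : normedModType R) (U : set V) (k : nat).
Hypothesis oU : open U.

Lemma diff_class_det n (M : V -> 'M[R]_n) :
  (forall i j, diff_class k U (fun x => M x i j)) ->
  diff_class k U (fun x => \det (M x)).
Proof.
move=> H; apply: diff_class_sum => // s; apply: diff_classM => //.
  exact: diff_class_cst.
exact: diff_class_prod.
Qed.

Lemma diff_class_invmx n (M : V -> 'M[R]_n) :
  (forall x, U x -> M x \in unitmx) ->
  (forall i j, diff_class k U (fun x => M x i j)) ->
  forall i j, diff_class k U (fun x => invmx (M x) i j).
Proof.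
move=> uM H i j; apply: (@diff_class_ext _ _ _ _ _
  (fun x => (\det (M x))^-1 * ((-1) ^+ (j + i) *
    \det (row' j (col' i (M x)))))) => //.
  by move=> x Ux; rewrite /invmx uM // !mxE.
apply: diff_classM => //.
  apply: diff_class_inv => //; last exact: diff_class_det.
  by move=> x Ux; have := uM x Ux; rewrite unitmxE unitfE.
apply: diff_classM => //; first exact: diff_class_cst.
apply: diff_class_det => a b; apply: diff_class_ext (H (lift j a) (lift i b)) => //.
by move=> x Ux; rewrite !mxE.
Qed.

End DiffClassMatrix.

Section LocalInverse.
Variable R : realType.

Lemma mean_value_le m n (f : 'rV[R]_m -> 'rV[R]_n) (a b : 'rV[R]_m) (c : R) :
  0 <= c ->
  (forall t : R, 0 <= t <= 1 -> differentiable f (b + t *: (a - b))) ->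
  (forall t : R, 0 <= t <= 1 ->
     `|'D_(a - b) f (b + t *: (a - b))| <= c) ->
  `|f a - f b| <= c.
Proof.
move=> c0 df Df; apply: row_norm_le => // i.
pose l (t : R) := b + t *: (a - b).
pose g (t : R) := f (l t) 0 i.
have dl (t : R) : is_diff t l (fun h => h *: (a - b)).
  have H : is_diff t (cst b + (fun h : R => h *: (a - b)))
      (0 + (fun h : R => h *: (a - b))) by apply: is_diffD.
  by move: H; rewrite add0r.
have dg (t : R) : 0 <= t <= 1 ->
    is_derive t (1 : R) g ('D_(a - b) f (l t) 0 i).
  move=> t01; have dft := df t t01.
  have dfl : differentiable (f \o l) t by apply: differentiable_comp.
  have dgt : differentiable g t.
    apply: (@differentiable_comp _ _ _ _ (f \o l) (fun M : 'rV[R]_n => M 0 i)) => //.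
    exact: differentiable_coord.
  apply: DeriveDef; first exact/derivable1_diffP.
  have -> : 'D_1 g t = ('D_(1 : R) (f \o l) t) 0 i.
    by rewrite [in RHS]derive_mx ?mxE //; exact: diff_derivable.
  rewrite deriveE // diff_comp //= (@diff_val _ _ _ _ _ _ _ (dl t)) scale1r.
  by rewrite -deriveE.
have cg : {within `[0, 1], continuous g}.
  apply: derivable_within_continuous => t; rewrite in_itv => t01.
  by have [] := dg t t01.
have [|t] := @MVT _ g (fun t => 'D_(a - b) f (l t) 0 i) 0 1 ltr01 _ cg.
  move=> t; rewrite in_itv /= => /andP[t0 t1]; apply: dg.
  by rewrite (ltW t0) ltW.
rewrite in_itv /= => /andP[t0 t1].
rewrite subr0 mulr1 /g /l scale1r scale0r addr0 [b + _]addrC subrK => E.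
rewrite !mxE E (le_trans (row_coord_le _ _)) //; apply: Df.
by rewrite (ltW t0) ltW.
Qed.

Lemma near_id_estimates n (A : set 'rV[R]_n) (H : 'rV[R]_n -> 'rV[R]_n) :
  open A -> A 0 -> smooth A H -> (forall v, 'D_v H 0 = v) ->
  exists2 e : R, 0 < e & forall w, `|w| <= e ->
    A w /\ forall v, `|v - 'D_v H w| <= 2^-1 * `|v|.
Proof.
move=> oA A0 sH DH.
have [dH cD] := sH 1%N.
pose c : R := (2 * n.+1%:R)^-1.
have c0 : 0 < c by rewrite invr_gt0 mulr_gt0.
have near_i : \forall w \near (0 : 'rV[R]_n), forall i : 'I_n,
    `|(delta_mx 0 i : 'rV[R]_n) - 'D_(delta_mx 0 i) H w| < c.
  apply: (filter_forall (nbhs_filter (0 : 'rV[R]_n))) => i.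
  have := cD (delta_mx 0 i) 0 A0; rewrite /prop_for /continuous_at DH.
  by move/cvgrPdist_lt => /(_ _ c0).
have near_A : \forall w \near (0 : 'rV[R]_n), A w by exact: open_nbhs_nbhs.
have [e /= e0 He] := (nbhs_normP _ _).1 (filterI near_i near_A).
exists (e / 2); first by rewrite divr_gt0.
move=> w we; have [|Hi Aw] := He w.
  rewrite /= sub0r normrN (le_lt_trans we) // ltr_pdivrMr // ltr_pMr //.
  by rewrite ltr1n.
split=> // v; have dHw := dH w Aw.
have -> : v - 'D_v H w = \sum_i v 0 i *: (delta_mx 0 i - 'D_(delta_mx 0 i) H w).
  rewrite deriveE // [in LHS](row_sum_delta v) linear_sum -sumrB.
  apply: eq_bigr => i _.
  by rewrite linearZ /= -deriveE // scalerBr.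
apply: (le_trans (ler_norm_sum _ _ _)).
apply: (@le_trans _ _ (\sum_(i < n) `|v| * c)).
  apply: ler_sum => i _; rewrite normrZ ler_pM //; first exact: row_coord_le.
  exact/ltW/Hi.
rewrite sumr_const card_ord -[_ *+ n]mulr_natl mulrCA mulrC ler_wpM2r //.
rewrite /c invfM mulrCA ler_piMr // ler_pdivrMr // mul1r ler_nat.
exact: leqnSn.
Qed.

Lemma closed_ball_compact n (e : R) : compact [set w : 'rV[R]_n | `|w| <= e].
Proof.
apply: bounded_closed_compact.
  rewrite /bounded_set /bounded_near; near=> M; move=> w /= we; apply: (le_trans we).
  by near: M; apply: nbhs_pinfty_ge; rewrite num_real.
apply: (@closed_comp _ _ (fun w : 'rV[R]_n => `|w|) [set x | x <= e]).
  by move=> w _; exact: norm_continuous.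
exact: closed_le.
Unshelve. all: by end_near. Qed.

(* On a ball where r w = w - H w is 1/2-Lipschitz, |H w - y| attains its minimum,
   and the step from w to y + r w halves it, so the minimum is 0. *)
Lemma local_lipschitz_inverse n (A : set 'rV[R]_n) (H : 'rV[R]_n -> 'rV[R]_n) :
  open A -> A 0 -> smooth A H -> H 0 = 0 -> (forall v, 'D_v H 0 = v) ->
  exists (e : R) (K : 'rV[R]_n -> 'rV[R]_n), [/\ 0 < e,
    K 0 = 0,
    forall y, `|y| < e -> [/\ A (K y), H (K y) = y &
      forall v, `|v - 'D_v H (K y)| <= 2^-1 * `|v|] &
    forall x y, `|x| < e -> `|y| < e -> `|K x - K y| <= 2 * `|x - y|].
Proof.
move=> oA A0 sH H0 DH.
have [e e0 He] := near_id_estimates oA A0 sH DH.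
have dH w : A w -> differentiable H w by have [dH _] := sH 1%N; exact: dH.
pose r w := w - H w.
have rle a b : `|a| <= e -> `|b| <= e -> `|r a - r b| <= 2^-1 * `|a - b|.
  move=> ae be.
  have le_e (t : R) : 0 <= t <= 1 -> `|b + t *: (a - b)| <= e.
    move=> /andP[t0 t1].
    have -> : b + t *: (a - b) = t *: a + (1 - t) *: b.
      by rewrite scalerBr scalerBl scale1r addrCA.
    rewrite (le_trans (ler_normD _ _)) // !normrZ ger0_norm //.
    rewrite ger0_norm ?subr_ge0 //.
    have -> : e = t * e + (1 - t) * e by rewrite -mulrDl addrC subrK mul1r.
    by rewrite lerD // ler_wpM2l // subr_ge0.
  apply: mean_value_le => [|t /le_e te|t /le_e te].
  - by rewrite mulr_ge0.
  - by apply: differentiableB => //; apply/dH/(He _ te).1.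
  - have dHt := dH _ (He _ te).1.
    rewrite deriveB; [|exact: derivable_id|exact: diff_derivable].
    by rewrite derive_id; exact: (He _ te).2.
have fixpt y : `|y| <= e / 2 -> exists2 w, `|w| <= e & H w = y.
  move=> ye.
  pose U := [set w : 'rV[R]_n | `|w| <= e].
  have [||w0 /set_mem Uw0 minw0] := @EVT_min_rV _ _ (fun w => `|H w - y|) U _
    (@closed_ball_compact n e).
  - by exists 0; rewrite /U /= normr0 ltW.
  - apply: continuous_in_subspaceT => w /set_mem /He[Aw _].
    apply: (@continuous_comp _ _ _ (fun w => H w - y) (fun w => `|w|)).
      apply/differentiable_continuous/differentiableB => //; exact: dH.
    exact: norm_continuous.
  pose w1 := y + r w0.
  have Uw1 : `|w1| <= e.
    have := rle w0 0 Uw0; rewrite normr0 (ltW e0) => /(_ isT).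
    rewrite {2}/r H0 !subr0 => rw; rewrite (le_trans (ler_normD _ _)) //.
    rewrite (splitr e) lerD // (le_trans rw) // mulrC ler_wpM2r //.
  have := minw0 w1 (mem_set Uw1).
  have -> : H w1 - y = r w0 - r w1.
    by rewrite /w1 /r; apply/rowP => i; rewrite !mxE; ring.
  have := rle w0 w1 Uw0 Uw1.
  have -> : w0 - w1 = H w0 - y.
    by rewrite /w1 /r; apply/rowP => i; rewrite !mxE; ring.
  move=> h1 h2; exists w0 => //; apply/eqP; rewrite -subr_eq0 -normr_le0.
  by have := le_trans h2 h1; lra.
have /choice[K HK] (y : 'rV[R]_n) : exists w, `|y| <= e / 2 -> `|w| <= e /\ H w = y.
  have [/fixpt[w we Hw]|_] := leP `|y| (e / 2); first by exists w.
  by exists 0.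
have Kle x y : `|x| <= e / 2 -> `|y| <= e / 2 -> `|K x - K y| <= 2 * `|x - y|.
  move=> xe ye; have [Kx HKx] := HK x xe; have [Ky HKy] := HK y ye.
  have := rle _ _ Kx Ky.
  rewrite /r HKx HKy => h.
  have := ler_normD ((K x - x) - (K y - y)) (x - y).
  have -> : (K x - x) - (K y - y) + (x - y) = K x - K y.
    by apply/rowP => i; rewrite !mxE; ring.
  lra.
have e2 : 0 < e / 2 by rewrite divr_gt0.
exists (e / 2), K; split => //.
- have [K0 HK0] := HK 0 (eq_ind_r (fun x => x <= e / 2) (ltW e2) (normr0 _)).
  have := rle _ 0 K0; rewrite normr0 (ltW e0) => /(_ isT).
  rewrite /r HK0 H0 !subr0 => h; apply/eqP; rewrite -normr_le0; lra.
- move=> y /ltW/HK[/He[AK DK] HKy]; split=> //.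
- by move=> x y /ltW xe /ltW ye; exact: Kle.
Qed.

Lemma mulmxr_bounded m n (M : 'M[R]_(m, n)) :
  exists2 C : R, 0 < C & forall x : 'rV[R]_m, `|x *m M| <= C * `|x|.
Proof.
pose S := \sum_(ij : 'I_m * 'I_n) `|M ij.1 ij.2|.
have S0 : 0 <= S by exact: sumr_ge0.
exists (1 + m%:R * S); first by rewrite ltr_wpDr // mulr_ge0.
move=> x; have N0 : 0 <= `|x| by [].
apply: row_norm_le => [|i]; first by rewrite mulr_ge0 // addr_ge0 // mulr_ge0.
rewrite mxE (le_trans (ler_norm_sum _ _ _)) //.
apply: (@le_trans _ _ (\sum_(j < m) S * `|x|)).
  apply: ler_sum => j _; rewrite normrM mulrC ler_pM //; last exact: row_coord_le.
  by rewrite /S (bigD1 (j, i)) //= lerDl sumr_ge0.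
rewrite sumr_const card_ord -[leLHS]mulr_natl mulrA ler_wpM2r //.
by rewrite lerDr.
Qed.

Lemma jacobian_near_id_unit n (H : 'rV[R]_n -> 'rV[R]_n) w :
  differentiable H w -> (forall v, `|v - 'D_v H w| <= 2^-1 * `|v|) ->
  jacobian H w \in unitmx.
Proof.
move=> dH Hv; rewrite -row_free_unit; apply: inj_row_free => v v0.
have := Hv v; rewrite deriveEjacobian // v0 subr0 => h.
by apply/eqP; rewrite -normr_le0; lra.
Qed.

Lemma local_inverse_differentiable n (H K : 'rV[R]_n -> 'rV[R]_n) (B : set 'rV[R]_n) y :
  open B -> B y -> (forall x, B x -> H (K x) = x) ->
  (forall x, B x -> `|K x - K y| <= 2 * `|x - y|) ->
  differentiable H (K y) -> jacobian H (K y) \in unitmx ->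
  differentiable K y /\ forall v, 'D_v K y = v *m invmx (jacobian H (K y)).
Proof.
move=> oB By HK lK dH uJ; set J := jacobian H (K y).
have [C C0 HC] := mulmxr_bounded (invmx J).
have [||dK dE] := @norm_le_differentiable _ _ _ K y (mulmxr (invmx J)).
- exact: mulmxr_continuous.
- move=> e e0.
  have c0 : 0 < e / (2 * C) by rewrite divr_gt0 // mulr_gt0.
  have [d /= d0 Hd] := (nbhs_normP _ _).1 (differentiable_norm_le dH c0).
  have nB : \forall h \near (0 : 'rV[R]_n), B (h + y).
    have : \forall x \near y, B x by exact: open_nbhs_nbhs.
    by rewrite (near_shift 0) /=; apply: filterS => h; rewrite subr0.
  have nd : \forall h \near (0 : 'rV[R]_n), `|h| < d / 2.
    by apply: nbhs0_lt; rewrite divr_gt0.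
  apply: filterS2 nB nd => h Bh hd.
  set k := K (h + y) - K y.
  have kh : `|k| <= 2 * `|h| by have := lK _ Bh; rewrite addrK.
  have := Hd k; rewrite /= sub0r normrN /k subrK HK // HK // addrK -/k.
  have -> : `|k| < d by lra.
  move=> /(_ isT); rewrite -deriveE // deriveEjacobian // -/J => hk.
  have -> : k - h *m invmx J = - ((h - k *m J) *m invmx J).
    by rewrite mulmxBl mulmxK // opprB.
  rewrite normrN (le_trans (HC _)) //.
  rewrite (@le_trans _ _ (C * (e / (2 * C) * (2 * `|h|)))) //.
    rewrite ler_pM2l // (le_trans hk) // ler_pM2l //.
  rewrite le_eqVlt; apply/orP; left; apply/eqP; field.
  by rewrite gt_eqF.
- by split=> // v; rewrite deriveE // dE.
Qed.

Lemma local_smooth_inverse n (A : set 'rV[R]_n) (H : 'rV[R]_n -> 'rV[R]_n) :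
  open A -> A 0 -> smooth A H -> H 0 = 0 -> (forall v, 'D_v H 0 = v) ->
  exists (B : set 'rV[R]_n) (K : 'rV[R]_n -> 'rV[R]_n), [/\ open B, B 0,
    smooth B K, K 0 = 0 & forall y, B y -> A (K y) /\ H (K y) = y].
Proof.
move=> oA A0 sH H0 DH.
have [e [K [e0 K0 HK lK]]] := local_lipschitz_inverse oA A0 sH H0 DH.
pose B := [set y : 'rV[R]_n | `|y| < e].
have oB : open B.
  apply: (@open_comp _ _ (fun w : 'rV[R]_n => `|w|) [set x | x < e]).
    by move=> w _; exact: norm_continuous.
  exact: open_lt.
have dH w : A w -> differentiable H w by have [dH _] := sH 1%N; exact: dH.
have uJ y : B y -> jacobian H (K y) \in unitmx.
  by move=> /HK[/dH ? _ ?]; exact: jacobian_near_id_unit.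
have dK y : B y -> differentiable K y /\
    forall v, 'D_v K y = v *m invmx (jacobian H (K y)).
  move=> By; apply: (@local_inverse_differentiable _ H K B) => //.
  - by move=> x /HK[].
  - by move=> x Bx; exact: lK.
  - by have [/dH] := HK y By.
  - exact: uJ.
exists B, K; split=> //; last by move=> y /HK[].
  by rewrite /B /= normr0.
(* Bootstrapping: K of class C^k makes D K = (D H o K)^-1 of class C^k. *)
elim=> [|k IH].
  by move=> y /dK[/differentiable_continuous].
split=> [y /dK[]//|v].
apply: (@diff_class_ext _ _ _ _ _ (fun y => v *m invmx (jacobian H (K y)))) => //.
  by move=> y /dK[_ ->].
apply: diff_class_row => // j.
apply: (@diff_class_ext _ _ _ _ _ 
  (fun y => \sum_i v 0 i * invmx (jacobian H (K y)) i j)) => //.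
  by move=> y _; rewrite mxE.
apply: diff_class_sum => // i; apply: diff_classM => //; first exact: diff_class_cst.
apply: (diff_class_invmx oB uJ) => a b.
apply: (@diff_class_ext _ _ _ _ _ (fun y => ('D_(delta_mx 0 a) H (K y)) 0 b)) => //.
  by move=> y /HK[/dH dHy _ _]; rewrite jacobian_coord.
apply: (diff_class_coord b oB).
have BA y : B y -> A (K y) by move=> /HK[].
exact: (@diff_class_comp _ _ _ _ k B A K _ oB BA IH ((sH k.+1).2 _)).
Qed.

End LocalInverse.

(** * Local sections of submersions and partitions of unity *)

Section Plots.
Variable R : realType.

Lemma diff_class_id (V : normedModType R) k (U : set V) : diff_class k U id.
Proof.
elim: k => [|k IH]; first by move=> x _.
split=> [x _|v]; first exact: ex_diff.
have -> : 'D_v (id : V -> V) = fun=> v by apply/funext => x; rewrite derive_id.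
exact: diff_class_cst.
Qed.

Lemma diff_class_mulmx (V : normedModType R) m n k (U : set V)
    (f : V -> 'rV[R]_m) (M : 'M[R]_(m, n)) : open U ->
  diff_class k U f -> diff_class k U (fun x => f x *m M).
Proof.
move=> oU cf; apply: (@diff_class_ext _ _ _ _ _
  (fun x => \sum_i f x 0 i *: row i M)) => //.
  by move=> x _; rewrite mulmx_sum_row.
by apply: diff_class_sum => // i; apply: diff_class_scale => //; exact: diff_class_coord.
Qed.

Lemma open_near_setI (T : topologicalType) (U : set T) (P : set T) x :
  open U -> U x -> (\forall y \near x, P y) ->
  exists A, [/\ open A, A x, A `<=` U & A `<=` P].
Proof.
move=> oU Ux nP; exists (U `&` P^°); split.
- by apply: openI => //; exact: open_interior.
- by [].
- by move=> y [].
- by move=> y [_ /interior_subset].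
Qed.

Lemma plot_sub (M : manifold R) k (U U' : set 'rV[R]_k) (p : 'rV[R]_k -> M) :
  U' `<=` U -> plot U p -> plot U' p.
Proof.
move=> sU [cp sp]; split=> [u /sU/cp//|c ac r].
by apply: diff_class_sub (sp c ac r) => u [/sU].
Qed.

Lemma plot_comp (M : manifold R) k l (V : set 'rV[R]_l) (P : 'rV[R]_l -> M)
    (U : set 'rV[R]_k) (q : 'rV[R]_k -> 'rV[R]_l) :
  open U -> open V -> plot V P -> smooth U q -> (forall u, U u -> V (q u)) ->
  plot U (P \o q).
Proof.
move=> oU oV pP sq UV.
have cq u : U u -> {for u, continuous q} by exact: (sq 0%N).
have cPq u : U u -> {for u, continuous (P \o q)}.
  by move=> Uu; apply: continuous_comp; [exact: cq|apply: pP.1; exact: UV].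
split=> // c ac r.
have oW : open (U `&` (P \o q) @^-1` chart_dom c).
  rewrite openE => u [Uu cu]; apply: filterI; first exact: open_nbhs_nbhs.
  by apply: (cPq u Uu); apply: open_nbhs_nbhs; split=> //; exact: chart_dom_open.
apply: (@diff_class_comp _ _ _ _ r _ (V `&` P @^-1` chart_dom c) q
  (chart_map c \o P) oW) (pP.2 c ac r) => [u [Uu cu]|].
  by split=> //; exact: UV.
by apply: diff_class_sub (sq r) => u [].
Qed.

Lemma submersion_local_section (M' M : manifold R) (f : M' -> M) (x0 : M') :
  submersion f -> exists (A : set M) (s : M -> M'), [/\ open A, A (f x0),
    forall x, A x -> f (s x) = x &
    forall k (U : set 'rV[R]_k) (p : 'rV[R]_k -> M), open U -> plot U p ->
      (forall u, U u -> A (p u)) -> plot U (s \o p)].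
Proof.
move=> [[cf sf] subf].
have [c ac cx] := atlas_cover x0; have [d ad dx] := atlas_cover (f x0).
pose z0 := chart_map c x0.
pose W := chart_map c @` (chart_dom c `&` f @^-1` chart_dom d).
pose F := chart_map d \o f \o chart_inv c.
have oW : open W.
  apply: chart_img_sub_open; apply: open_comp; last exact: chart_dom_open.
  by move=> x _; exact: cf.
have Wz0 : W z0 by exists x0.
have sF : smooth W F by exact: (sf d ad c ac).
have /choice[v Hv] (j : 'I_(chart_dim d)) : exists v,
    'd F z0 v = delta_mx 0 j by exact: subf.
pose T : 'M[R]_(chart_dim d, chart_dim c) := \matrix_(j < chart_dim d) v j.
pose a (w : 'rV[R]_(chart_dim d)) := z0 + w *m T.
have dF z : W z -> differentiable F z by have [dF _] := sF 1%N; exact: dF.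
have sa U : open U -> smooth U a.
  move=> oU k; apply: diff_classD => //; first exact: diff_class_cst.
  by apply: diff_class_mulmx => //; exact: diff_class_id.
have oA : open (a @^-1` W).
  by apply: open_comp => // w _; exact: (sa setT openT 0%N w I).
pose H w := F (a w) - F z0.
have a0 : a 0 = z0 by rewrite /a mul0mx addr0.
have [|||w|B [K [oB B0 sK K0 HK]]] := @local_smooth_inverse R _ (a @^-1` W) H oA.
- by rewrite /= a0.
- move=> k; apply: diff_classD => //; last exact: diff_class_cst.
  by apply: (@diff_class_comp _ _ _ _ k _ W a F oA) => //; exact: sa.
- by rewrite /H a0 subrr.
- have [da ae] : differentiable a 0 /\ 'd a 0 = mulmxr T :> (_ -> _).
    apply: norm_le_differentiable => [|e e0]; first exact: mulmxr_continuous.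
    near=> h; rewrite /a /= addr0 mul0mx addr0 [z0 + _]addrC addrK.
    by rewrite subrr normr0 mulr_ge0 // ltW.
  have dFa : differentiable (F \o a) 0.
    by apply: differentiable_comp => //; apply: dF; rewrite a0.
  rewrite (_ : H = (F \o a) - cst (F z0)) // deriveB //; last first.
    exact: diff_derivable.
  rewrite derive_cst subr0 deriveE // diff_comp //; last by apply: dF; rewrite a0.
  rewrite /= ae a0 /= mulmx_sum_row linear_sum [RHS]row_sum_delta.
  by apply: eq_bigr => j _; rewrite linearZ /= rowK Hv.
pose A := chart_dom d `&` [set x | B (chart_map d x - F z0)].
have oAA : open A.
  rewrite openE => x [dxx Bx]; apply: filterI.
    by apply: open_nbhs_nbhs; split=> //; exact: chart_dom_open.
  have : {for x, continuous (fun x => chart_map d x - F z0)}.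
    by apply: cvgB; [exact: chart_map_continuous|exact: cvg_cst].
  by apply; apply: open_nbhs_nbhs.
pose q x := a (K (chart_map d x - F z0)).
exists A, (chart_inv c \o q).
have Aq x : A x -> W (q x) /\ F (q x) = chart_map d x.
  move=> [_ /HK[Wq]]; rewrite /H => /eqP; rewrite subr_eq subrK => /eqP E.
  by split.
split=> //.
- split=> //=; rewrite /F /= chart_mapK // subrr //.
- move=> x Ax; have [[x1 [cx1 dx1] qE] Fq] := Aq _ Ax.
  move: Fq; rewrite /= /F /= -qE chart_mapK // => E.
  by rewrite -[LHS](chart_mapK dx1) E chart_mapK //; case: Ax.
- move=> k U p oU pp UA.
  have := @plot_comp M' k _ W (chart_inv c) U (q \o p) oU oW.
  apply.
  + exact: chart_inv_plot.
  + move=> r.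
    have dp : diff_class r U (chart_map d \o p).
      apply: diff_class_sub (pp.2 d ad r) => u Uu; split=> //.
      by have [] := UA u Uu.
    have dp' : diff_class r U (fun u => chart_map d (p u) - F z0).
      by apply: diff_classD => //; exact: diff_class_cst.
    have dK : diff_class r U (K \o (fun u => chart_map d (p u) - F z0)).
      apply: (@diff_class_comp _ _ _ _ r U B) => //.
      by move=> u /UA[].
    by apply: (@diff_class_comp _ _ _ _ r U setT _ a oU _ dK); last exact: sa openT _.
  + by move=> u /UA/Aq[].
Unshelve. all: by end_near. Qed.

End Plots.

Lemma sum_ord_stable (V : nmodType) (c : nat -> V) m n :
  (forall k, (m <= k)%N -> c k = 0) -> (forall k, (n <= k)%N -> c k = 0) ->
  \sum_(i < m) c i = \sum_(i < n) c i.
Proof.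
wlog mn : m n / (m <= n)%N.
  by move=> H cm cn; have [/H|/ltnW/H h] := leqP m n; [exact|apply/esym/h].
move=> cm _; rewrite -!(big_mkord xpredT) [RHS](big_cat_nat (n := m)) //=.
rewrite [X in _ = _ + X]big_nat_cond [X in _ = _ + X]big1 ?addr0 //.
by move=> i /andP[/andP[/cm]].
Qed.

Section PartitionOfUnity.
Variables (R : realType) (M : manifold R).

(* Smoothness is only ever needed along plots. *)
Definition plot_smooth (b : M -> R) : Prop :=
  forall k (U : set 'rV[R]_k) (p : 'rV[R]_k -> M), open U -> plot U p ->
    smooth U (b \o p).

Lemma plot_smooth_local (b : M -> R) :
  (forall x : M, exists b' : M -> R, plot_smooth b' /\ \forall y \near x, b y = b' y) ->
  plot_smooth b.
Proof.
move=> H k U p oU pp r; apply: diff_class_cover => u Uu.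
have [b' [sb' nb']] := H (p u).
have [A [oA Au AU Ab]] := open_near_setI oU Uu (pp.1 u Uu _ nb').
exists A => //; apply: (@diff_class_ext _ _ _ _ _ (b' \o p)) => //.
  by move=> y /Ab /= ->.
by apply: (sb' k A p oA) => //; exact: plot_sub pp.
Qed.

Lemma plot_smoothM b c : plot_smooth b -> plot_smooth c ->
  plot_smooth (fun x => b x * c x).
Proof.
by move=> sb sc k U p oU pp r; apply: diff_classM => //; [exact: sb|exact: sc].
Qed.

Lemma plot_smooth_cst a : plot_smooth (fun=> a).
Proof. by move=> k U p oU pp r; exact: diff_class_cst. Qed.

Lemma plot_smooth_sum (I : Type) (r : seq I) (F : I -> M -> R) :
  (forall i, plot_smooth (F i)) -> plot_smooth (fun x => \sum_(i <- r) F i x).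
Proof.
by move=> sF k U p oU pp l; apply: diff_class_sum => // i; exact: sF.
Qed.

Lemma plot_smooth_prod (I : Type) (r : seq I) (F : I -> M -> R) :
  (forall i, plot_smooth (F i)) -> plot_smooth (fun x => \prod_(i <- r) F i x).
Proof.
by move=> sF k U p oU pp l; apply: diff_class_prod => // i; exact: sF.
Qed.

Lemma plot_smooth_continuous b : plot_smooth b -> continuous b.
Proof.
move=> sb x; have [c ac cx] := atlas_cover x.
have cbc := sb _ _ (chart_inv c) (chart_img_open (c := c)) _ 0%N (chart_map c x).
have nE : \forall y \near x, (b \o chart_inv c \o chart_map c) y = b y.
  have : \forall y \near x, chart_dom c y.
    by apply: open_nbhs_nbhs; split=> //; exact: chart_dom_open.
  by apply: filterS => y cy /=; rewrite chart_mapK.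
rewrite /continuous_at -(chart_mapK cx).
have cc : {for x, continuous (b \o chart_inv c \o chart_map c)}.
  apply: continuous_comp; first exact: chart_map_continuous.
  apply: cbc; last by exists x.
  have := @chart_inv_plot _ _ c setT ac; rewrite setIT; apply.
rewrite chart_mapK //; move: cc; rewrite /prop_for /continuous_at /= chart_mapK //.
by move=> cc; apply: cvg_trans cc; exact: near_eq_cvg.
Qed.

Lemma exists_bump (A : set M) x0 : open A -> A x0 -> exists b : M -> R,
  [/\ plot_smooth b, forall x, 0 <= b x, 0 < b x0 &
      forall x, ~ A x -> \forall y \near x, b y = 0].
Proof.
move=> oA Ax0; have [c ac cx] := atlas_cover x0.
pose z0 := chart_map c x0.
pose W := chart_map c @` (chart_dom c `&` A).
have oW : open W by exact: chart_img_sub_open.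
have Wz0 : W z0 by exists x0.
have [e /= e0 He] := (nbhs_normP _ _).1 (open_nbhs_nbhs (conj oW Wz0)).
pose d := e / 2.
have d0 : 0 < d by rewrite divr_gt0.
have Hd (w : 'rV[R]_(chart_dim c)) : `|w| <= d -> W (z0 + w).
  move=> wd; apply: He => /=; rewrite opprD addrA subrr sub0r normrN.
  by rewrite (le_lt_trans wd) // /d ltr_pdivrMr // ltr_pMr // ltr1n.
pose C := (fun w : 'rV[R]_(chart_dim c) => chart_inv c (z0 + w)) @`
  [set w : 'rV[R]_(chart_dim c) | `|w| <= d].
have clC : closed C.
  apply: compact_closed; first exact: manifold_hausdorff.
  apply: continuous_compact; last exact: closed_ball_compact.
  apply: continuous_in_subspaceT => w /set_mem /= /Hd[y [cy _] yE].
  apply: (@continuous_comp _ _ _ (fun w => z0 + w) (chart_inv c)).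
    apply: (@diff_classD _ _ _ 0%N setT (fun=> z0) id openT _ _ w I).
      exact: diff_class_cst.
    exact: diff_class_id.
  by apply: chart_inv_continuous; exists y.
have CA : C `<=` chart_dom c `&` A.
  by move=> _ [w /= /Hd[y [cy Ay] <-]] <-; rewrite chart_mapK.
pose h (z : 'rV[R]_(chart_dim c)) := d ^+ 2 - \sum_j (z 0 j - z0 0 j) ^+ 2.
pose b x := if `[< chart_dom c x >] then flat 0 (h (chart_map c x)) else 0.
have bC x : ~ C x -> b x = 0.
  move=> nC; rewrite /b; case: asboolP => // cdx; apply/eqP.
  rewrite eq_le flat_ge0 andbT leNgt flat_gt0; apply/negP => hx; apply: nC.
  exists (chart_map c x - z0) => /=; last by rewrite addrC subrK chart_mapK.
  apply: row_norm_le => [|j]; first exact: ltW.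
  rewrite -(ger0_norm (ltW d0)) -ler_sqr ?nnegrE // !real_normK ?num_real //.
  rewrite !mxE; move: hx; rewrite /h subr_gt0 (bigD1 j) //= => hx.
  apply: ltW; apply: le_lt_trans hx; rewrite lerDl.
  by apply: sumr_ge0 => i _; exact: sqr_ge0.
have nCb x : ~ C x -> \forall y \near x, b y = 0.
  move=> nC; have : \forall y \near x, (~` C) y.
    by apply: open_nbhs_nbhs; split=> //; exact: closed_openC.
  by apply: filterS => y; exact: bC.
exists b; split.
- move=> k U p oU pp r; apply: diff_class_cover => u Uu.
  have [cu|ncu] := pselect (chart_dom c (p u)); last first.
    have nb : \forall y \near u, b (p y) = 0.
      by apply: (pp.1 u Uu _ (nCb _ _)) => /CA[].
    have [B [oB Bu BU Bb]] := open_near_setI oU Uu nb.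
    exists B => //; apply: (@diff_class_ext _ _ _ _ _ (fun=> 0)) => //.
      by move=> y /Bb /= ->.
    exact: diff_class_cst.
  have oV : open (U `&` p @^-1` chart_dom c).
    by apply: plot_open => //; exact: chart_dom_open.
  exists (U `&` p @^-1` chart_dom c) => //.
  apply: (@diff_class_ext _ _ _ _ _ (fun u => flat 0 (h (chart_map c (p u))))) => //.
    by move=> y [_ cy] /=; rewrite /b asboolT.
  apply: diff_class_flat => //; apply: diff_classD => //.
    exact: diff_class_cst.
  apply: (@diff_class_ext _ _ _ _ _ (fun u => (-1) * \sum_j
    ((chart_map c (p u) 0 j - z0 0 j) * (chart_map c (p u) 0 j - z0 0 j)))) => //.
    by move=> y _ /=; rewrite mulN1r; congr (- _); apply: eq_bigr => j _; rewrite expr2.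
  apply: diff_classM => //; first exact: diff_class_cst.
  have dj j : diff_class r (U `&` p @^-1` chart_dom c)
      (fun u => chart_map c (p u) 0 j - z0 0 j).
    apply: diff_classD => //; last exact: diff_class_cst.
    by apply: diff_class_coord => //; exact: (pp.2 c ac r).
  by apply: diff_class_sum => // j; apply: diff_classM => //; exact: dj.
- by move=> x; rewrite /b; case: ifP => // _; exact: flat_ge0.
- rewrite /b asboolT // flat_gt0 /h big1 ?subr0 ?exprn_gt0 // => j _.
  by rewrite subrr expr0n.
- by move=> x nA; apply: nCb => /CA[].
Qed.

Lemma plot_smooth_gt0_open (b : M -> R) : plot_smooth b ->
  open [set x | 0 < b x].
Proof.
move=> sb; apply: (@open_comp _ _ b [set y | 0 < y]); last exact: open_gt.
by move=> x _; exact: plot_smooth_continuous.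
Qed.

Lemma countable_bump_cover (Q : set M -> Prop) :
  (forall x, exists A, [/\ open A, A x & Q A]) -> Q set0 ->
  exists (b : nat -> M -> R) (A : nat -> set M), [/\ forall k, plot_smooth (b k),
    forall k x, 0 <= b k x, forall x, exists k, 0 < b k x,
    forall k x, ~ A k x -> \forall y \near x, b k y = 0 & forall k, Q (A k)].
Proof.
move=> cov Q0; have [B /countable_injP[f finj] [_ nB]] := @manifold_second_countable _ M.
pose good (bA : (M -> R) * set M) := [/\ plot_smooth bA.1,
  forall x, 0 <= bA.1 x, forall x, ~ bA.2 x -> \forall y \near x, bA.1 y = 0 &
  Q bA.2].
have good0 : good (fun=> 0, set0).
  split=> //= [|x _]; first exact: plot_smooth_cst.
  near=> y; reflexivity.
have /choice[bA HbA] (k : nat) : exists bA, good bA /\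
    forall V bA', B V -> f V = k -> good bA' ->
      V `<=` [set x | 0 < bA'.1 x] -> V `<=` [set x | 0 < bA.1 x].
  have [[V [bA' [BV fV gA VA]]]|H] := pselect (exists V bA', [/\ B V, f V = k,
      good bA' & V `<=` [set x | 0 < bA'.1 x]]).
    exists bA'; split=> // V' bA'' BV' fV' _ _.
    by rewrite (finj V' V) ?inE // fV'.
  exists (fun=> 0, set0); split=> // V bA' BV fV gA VA; exfalso; apply: H.
  by exists V, bA'.
exists (fun k => (bA k).1), (fun k => (bA k).2); split.
- by move=> k; have [[]] := HbA k.
- by move=> k; have [[]] := HbA k.
- move=> x; have [A [oA Ax QA]] := cov x.
  have [b [sb b0 bx nb]] := exists_bump oA Ax.
  have : nbhs x [set x | 0 < b x].
    by apply: open_nbhs_nbhs; split=> //; exact: plot_smooth_gt0_open.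
  move=> /nB[V [BV Vx] Vb]; exists (f V).
  have [_ H] := HbA (f V).
  by apply: (H V (b, A)).
- by move=> k; have [[]] := HbA k.
- by move=> k; have [[]] := HbA k.
Unshelve. all: by end_near. Qed.

Definition locally_finite (c : nat -> M -> R) : Prop :=
  forall x : M, exists N, \forall y \near x, forall k, (N <= k)%N -> c k y = 0.

(* With b_j > d > 0 near x, the factor flat 0 (1/(k+1) - b_j) kills c_k near x as
   soon as k > j and 1/(k+1) <= d; and c_k x > 0 for the least k with b_k x > 0. *)
Lemma locally_finite_refinement (b : nat -> M -> R) :
  (forall k, plot_smooth (b k)) -> (forall k x, 0 <= b k x) ->
  (forall x, exists k, 0 < b k x) ->
  exists c : nat -> M -> R, [/\ forall k, plot_smooth (c k),
    forall k x, 0 <= c k x, forall x, exists k, 0 < c k x,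
    forall k x, b k x = 0 -> c k x = 0 & locally_finite c].
Proof.
move=> sb b0 bpos.
pose c k x := b k x * \prod_(j < k) flat 0 ((k.+1%:R)^-1 - b j x).
exists c; split.
- move=> k; apply: plot_smoothM => //; apply: plot_smooth_prod => j l U p oU pp r.
  apply: diff_class_flat => //; apply: diff_classD => //.
    exact: diff_class_cst.
  apply: (@diff_class_ext _ _ _ _ _ (fun u => (-1) * b j (p u))) => //.
    by move=> u _; rewrite mulN1r.
  by apply: diff_classM => //; [exact: diff_class_cst|exact: sb].
- move=> k x; rewrite mulr_ge0 // prodr_ge0 // => j _; exact: flat_ge0.
- move=> x; have bx : exists k, 0 < b k x by exact: bpos.
  exists (ex_minn bx); case: ex_minnP => k bk kmin.
  rewrite mulr_gt0 // prodr_gt0 // => j _; rewrite flat_gt0.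
  have -> : b j x = 0.
    apply/eqP; rewrite eq_le b0 andbT leNgt; apply/negP => /kmin.
    by rewrite leqNgt ltn_ord.
  by rewrite subr0 invr_gt0.
- by move=> k x bk; rewrite /c bk mul0r.
- move=> x; have [j bj] := bpos x.
  pose d := b j x / 2; have d0 : 0 < d by rewrite divr_gt0.
  pose N := maxn j.+1 (Num.truncn d^-1).+1; exists N.
  have : \forall y \near x, d < b j y.
    have cb : {for x, continuous (b j)} by exact: plot_smooth_continuous.
    apply: (cb [set y | d < y]); apply: open_nbhs_nbhs; split; first exact: open_gt.
    by rewrite /= /d ltr_pdivrMr // ltr_pMr // ltr1n.
  apply: filterS => y dy k; rewrite geq_max => /andP[jk Nk].
  rewrite /c (bigD1 (Ordinal jk)) //=; apply/eqP; rewrite !mulf_eq0.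
  apply/orP; right; apply/orP; left.
  rewrite eq_le flat_ge0 andbT leNgt flat_gt0 subr_gt0 -leNgt.
  apply: le_trans (ltW dy); rewrite invf_ple ?posrE //.
  apply/ltW/(lt_le_trans (truncnS_gt _)); rewrite ler_nat; exact: leqW.
Qed.

Lemma partition_of_unity (Q : set M -> Prop) :
  (forall x, exists A, [/\ open A, A x & Q A]) -> Q set0 ->
  exists (w : nat -> M -> R) (A : nat -> set M), [/\ forall k, plot_smooth (w k),
    locally_finite w,
    forall x n, (forall k, (n <= k)%N -> w k x = 0) -> \sum_(k < n) w k x = 1,
    forall k x, ~ A k x -> \forall y \near x, w k y = 0 & forall k, Q (A k)].
Proof.
move=> cov Q0.
have [b [A [sb b0 bpos bA QA]]] := countable_bump_cover cov Q0.
have [c [sc c0 cpos cb lfc]] := locally_finite_refinement sb b0 bpos.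
have /choice[N HN] := lfc.
pose S x := \sum_(k < N x) c k x.
have SE x n : (forall k, (n <= k)%N -> c k x = 0) -> S x = \sum_(k < n) c k x.
  move=> cn; apply: (@sum_ord_stable _ (fun k => c k x)) => //.
  exact: nbhs_singleton (HN x).
have S0 x : S x != 0.
  have [k ck] := cpos x; rewrite (SE x (maxn k.+1 (N x))); last first.
    move=> l; rewrite geq_max => /andP[_]; exact: nbhs_singleton (HN x) l.
  have kN : (k < maxn k.+1 (N x))%N by rewrite leq_max leqnn.
  rewrite gt_eqF // (bigD1 (Ordinal kN)) //= ltr_wpDr //.
  by apply: sumr_ge0.
have sS : plot_smooth S.
  apply: plot_smooth_local => x; exists (fun y => \sum_(k < N x) c k y).
  split; first exact: plot_smooth_sum.
  by move: (HN x); apply: filterS => y; exact: SE.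
exists (fun k x => c k x / S x), A; split=> //.
- move=> k; apply: plot_smoothM => // l U p oU pp r.
  by apply: diff_class_inv => //; exact: sS.
- move=> x; exists (N x); move: (HN x); apply: filterS => y Hy k /Hy ->.
  by rewrite mul0r.
- move=> x n Hn; rewrite -mulr_suml -SE ?mulfV // => k /Hn/eqP.
  by rewrite mulf_eq0 invr_eq0 (negbTE (S0 x)) orbF => /eqP.
- move=> k x /bA; apply: filterS => y /cb ->; by rewrite mul0r.
Qed.

End PartitionOfUnity.

(** * The prism homotopy *)

Section Cast.
Variables (R : realType) (M : manifold R) (E : vbundle M).

(* Transport made total, with the junk value 0 when x <> y: the prism identity can
   then be stated for simplices indexed by plain natural numbers. *)
Definition cast (x y : M) (v : E x) : E y :=
  if pselect (x = y) is left e then transport E e v else 0.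

Lemma castE x y (e : x = y) (v : E x) : cast y v = transport E e v.
Proof.
rewrite /cast; case: pselect => [e'|//].
by rewrite (Prop_irrelevance e' e).
Qed.

Lemma cast_id x (v : E x) : cast x v = v.
Proof. by rewrite (castE erefl). Qed.

Lemma cast_trans x y z (v : E x) : x = y -> cast z (cast y v) = cast z v.
Proof. by move=> e; case: y / e; rewrite cast_id. Qed.

Lemma cast_linear x y : linear (@cast x y).
Proof.
move=> a v w; rewrite /cast; case: pselect => [e|_].
  by rewrite transportD transportZ.
by rewrite scaler0 addr0.
Qed.

HB.instance Definition _ x y := GRing.isLinear.Build R (E x) (E y) _
  (@cast x y) (@cast_linear x y).

End Cast.

Section ChainExt.
Variables (R : realType) (G : lie_groupoid R).

Lemma order_map_ext p n (a b : order_map p n) : a =1 b -> a = b.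
Proof.
case: a b => [a pa] [b pb] /= /funext e; case: b / e pb => pb.
by rewrite (Prop_irrelevance pa pb).
Qed.

Definition order_comp p q n (a : order_map q n) (b : order_map p q) : order_map p n :=
  OrderMap (fun i j h => order_funP a (order_funP b h)).

Lemma degenerate_subchain n (g : chain G n) p (a : order_map p n)
    (i j : 'I_p.+1) : j = i.+1 :> nat -> a i = a j -> degenerate (subchain g a).
Proof.
move=> ij aij.
have hij : (i <= j)%N by rewrite ij.
exists i, j, hij, (obj g (a i)); split=> //=.
move: (order_funP a hij); rewrite -aij => h.
by have [_ -> _] := chainP g.
Qed.

End ChainExt.

Section LCochains.
Variables (R : realType) (G : lie_groupoid R) (E : graded_vbundle (objects G)).

Section Coboundary.
Variable L : objects G -> Type.

(* A chain of G together with a point of L x at each vertex x. When L x is the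
   fibre of phi_0 over x, these are the chains of G', by the cartesian square. *)
Definition decoration n (g : chain G n) : Type := forall k, L (obj g k).

Definition subdecoration p n (g : chain G n) (a : order_map p n)
  (y : decoration g) : decoration (subchain g a) := fun k => y (a k).

Definition lcochains : Type := forall i (j : int) (g : chain G i),
  decoration g -> E (- j) (chain_tgt g).

Variable rho : ruth E.

Definition lcoboundary_op m k (h : (m <= k)%N) (c : lcochains) (j' : int)
    (g : chain G k) (y : decoration g) : E (- j') (chain_tgt g) :=
  let i := (k - m)%N in
  let j := j' + m%:Z - 1 in
  (-1 : R) ^ j *:
    transport (E (- j')) (chain_tgt_tau h g)
      (ruth_op rho m (subchain g (tau_map h)) (- j) (- j')
        (transport (E (- j))
          (chain_cut (leq_subr m k) h g (subnK h))
          (c i j (subchain g (iota_map (leq_subr m k)))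
             (subdecoration (iota_map (leq_subr m k)) y)))).

Definition lcoboundary_faces k (c : lcochains) (j : int) :
    forall g : chain G k, decoration g -> E (- j) (chain_tgt g) :=
  match k with
  | i.+1 => fun g y =>
      (-1 : R) ^ (i%:Z + j + 1) *: \sum_(r < i.+1) (-1) ^+ r *:
        transport (E (- j)) (chain_tgt_delta g (outer_vertex_lt r))
          (c i j (subchain g (delta_map (widen_ord (leqnSn i.+1) r)))
             (subdecoration (delta_map (widen_ord (leqnSn i.+1) r)) y))
  | 0 => fun _ _ => 0
  end.

Definition lcoboundary (c : lcochains) : lcochains := fun k j g y =>
  (\sum_(m < k.+1) lcoboundary_op (leq_ord m) c j y) +
  lcoboundary_faces c j y.

Lemma lcochain_irrelevant (c : lcochains) n obj arr
    (p q : @chain_axiom R G n obj arr) j (y : forall k, L (obj k)) :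
  c n j (Chain p) y = c n j (Chain q) y.
Proof. by case: _ / (Prop_irrelevance p q). Qed.

Lemma lcoboundary_opE m k (h : (m <= k)%N) (c : lcochains) (j : int)
    (g : chain G k) (y : decoration g) :
  lcoboundary_op h c j y =
  (-1 : R) ^ (j + m%:Z - 1) *: cast (chain_tgt g)
    (ruth_op rho m (subchain g (tau_map h)) (- (j + m%:Z - 1)) (- j)
      (cast (chain_src (subchain g (tau_map h)))
        (c (k - m)%N (j + m%:Z - 1) (subchain g (iota_map (leq_subr m k)))
             (subdecoration (iota_map (leq_subr m k)) y)))).
Proof.
by rewrite /lcoboundary_op (castE (chain_tgt_tau h g))
  (castE (chain_cut (leq_subr m k) h g (subnK h))).
Qed.

Lemma lcoboundary_facesE i (c : lcochains) (j : int) (g : chain G i.+1)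
    (y : decoration g) :
  lcoboundary_faces c j y =
  (-1 : R) ^ (i%:Z + j + 1) *: \sum_(r < i.+1) (-1) ^+ r *:
    cast (chain_tgt g)
      (c i j (subchain g (delta_map (widen_ord (leqnSn i.+1) r)))
         (subdecoration (delta_map (widen_ord (leqnSn i.+1) r)) y)).
Proof.
rewrite /=; congr (_ *: _); apply: eq_bigr => r _.
by rewrite (castE (chain_tgt_delta g (outer_vertex_lt r))).
Qed.

End Coboundary.

End LCochains.

Section SumLemma.
Variables (R : comPzRingType) (V : lmodType R).

Lemma prism_face_sum n (a b : nat -> nat -> V) (M : nat -> V) :
  (forall k, (k <= n)%N -> a k k = M k) ->
  (forall k, (k < n)%N -> a k k.+1 = M k.+1) ->
  (forall k r, (r <= k)%N -> (k < n)%N -> a k.+1 r = b r k) ->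
  (forall k r, (k < r)%N -> (r < n)%N -> a k r.+1 = b r k) ->
  \sum_(k < n.+1) \sum_(r < n.+1) (-1) ^+ (k + r) *: a k r +
  \sum_(k < n) \sum_(r < n) (-1) ^+ (k + r) *: b r k = M 0%N.
Proof.
move=> aM aM' ab ab'.
pose S k r := (-1) ^+ (k + r) *: a k r.
pose B k r := (-1) ^+ (k + r) *: b r k.
have Slt k : (k < n)%N -> \sum_(r < n.+1) S k r =
    \sum_(0 <= r < k) S k r + M k - M k.+1 - \sum_(k.+1 <= r < n) B k r.
  move=> kn; rewrite -(big_mkord xpredT) (big_cat_nat (n := k)) //=; last first.
    by rewrite ltnW // ltnW.
  rewrite (big_ltn (m := k)); last by rewrite ltnW.
  rewrite (big_ltn (m := k.+1)) // big_add1 /=.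
  rewrite -!addrA; congr (_ + _); rewrite {1}/S addnn -muln2 exprM sqrr_sign.
  rewrite scale1r aM 1?ltnW //; congr (_ + _).
  rewrite {1}/S addnS addnn exprS -muln2 exprM sqrr_sign mulr1 scaleN1r aM' //.
  congr (_ + _); rewrite -sumrN; apply: eq_big_nat => r /andP[kr rn].
  by rewrite /S /B addnS exprS mulN1r scaleNr ab'.
have Sn : \sum_(r < n.+1) S n r = \sum_(0 <= r < n) S n r + M n.
  rewrite big_ord_recr /= -(big_mkord xpredT); congr (_ + _).
  by rewrite /S addnn -muln2 exprM sqrr_sign scale1r aM.
have Slow k : (k < n)%N -> \sum_(0 <= r < k.+1) S k.+1 r = - \sum_(0 <= r < k.+1) B k r.
  move=> kn; rewrite -sumrN; apply: eq_big_nat => r /andP[_ rk].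
  by rewrite /S /B addSn exprS mulN1r scaleNr ab.
have Bsplit k : (k < n)%N -> \sum_(r < n) B k r =
    \sum_(0 <= r < k.+1) B k r + \sum_(k.+1 <= r < n) B k r.
  by move=> kn; rewrite -(big_mkord xpredT) (big_cat_nat (n := k.+1)).
rewrite -/S big_ord_recr /= Sn.
under eq_bigr => k _ do rewrite (Slt k (ltn_ord k)).
under [X in _ + X]eq_bigr => k _ do rewrite (Bsplit k (ltn_ord k)).
have low : \sum_(k < n) \sum_(0 <= r < k) S k r + \sum_(0 <= r < n) S n r =
    - \sum_(k < n) \sum_(0 <= r < k.+1) B k r.
  rewrite -(big_ord_recr n (fun k => \sum_(0 <= r < k) S k r)) /=.
  rewrite big_ord_recl /= big_geq // add0r -sumrN; apply: eq_bigr => k _.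
  exact: Slow.
have tele : \sum_(k < n) M k - \sum_(k < n) M k.+1 + M n = M 0%N.
  apply/eqP; rewrite addrAC subr_eq; apply/eqP.
  by rewrite -(big_ord_recr n (fun i : 'I_n.+1 => M i)) big_ord_recl.
rewrite !big_split /= !sumrN.
set P1 := \sum_(k < n) \sum_(0 <= r < k) S k r in low *.
set P2 := \sum_(0 <= r < n) S n r in low *.
set Q := \sum_(k < n) \sum_(0 <= r < k.+1) B k r in low *.
set W := \sum_(k < n) \sum_(k.+1 <= r < n) B k r.
set M0 := \sum_(k < n) M k in tele *.
set M1 := \sum_(k < n) M k.+1 in tele *.
rewrite -tele.
have -> : Q = - (P1 + P2) by rewrite low opprK.
rewrite opprD.
rewrite (AC (4*2*3) ((1*7)*(5*8)*(4*9)*(2*3*6)))%AC.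
by rewrite /= !subrr addNr !add0r.
Qed.

End SumLemma.

Lemma unbump_map_ltn n (k : 'I_n.+1) (i : 'I_n.+2) : (unbump k i < n.+1)%N.
Proof.
rewrite /unbump; have := ltn_ord i; have := ltn_ord k; case: ltnP => ki; lia.
Qed.

Lemma sigma_map_subproof n (k : 'I_n.+1) (i j : 'I_n.+2) : (i <= j)%N ->
  (Ordinal (unbump_map_ltn k i) <= Ordinal (unbump_map_ltn k j))%N.
Proof. by rewrite /= /unbump; case: ltnP; case: ltnP; lia. Qed.

Definition sigma_map n (k : 'I_n.+1) : order_map n.+1 n :=
  OrderMap (@sigma_map_subproof n k).

Lemma mono_map_subproof p n (f : nat -> nat) (i j : 'I_p.+1) : (i <= j)%N ->
  ((inord (minn n (\max_(l < i.+1) f l)) : 'I_n.+1) <=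
   (inord (minn n (\max_(l < j.+1) f l)) : 'I_n.+1))%N.
Proof.
move=> ij; rewrite !inordK ?ltnS ?geq_minl // leq_min geq_minl /= .
rewrite (leq_trans (geq_minr _ _)) //; apply/bigmax_leqP => l _.
exact: (leq_bigmax (Ordinal (leq_trans (ltn_ord l) (ij : (i < j.+1)%N)))).
Qed.

(* The running maximum of f, cut off at n: f itself if f is order-preserving with
   values at most n. *)
Definition mono_map p n (f : nat -> nat) : order_map p n :=
  OrderMap (@mono_map_subproof p n f).

Lemma mono_mapE p n (a : order_map p n) (f : nat -> nat) :
  (forall i, a i = f i :> nat) -> mono_map p n f = a.
Proof.
move=> af; apply: order_map_ext => i; apply: val_inj => /=.
have -> : \max_(l < i.+1) f l = f i.
  apply/eqP; rewrite eqn_leq (@leq_bigmax _ (fun l : 'I_i.+1 => f l) ord_max) andbT.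
  apply/bigmax_leqP => l _; have li : (l < p.+1)%N by rewrite (leq_trans (ltn_ord l)).
  by rewrite -(af (Ordinal li)) -(af i); apply: order_funP; rewrite -ltnS /=.
by rewrite -af inordK ?(minn_idPr _) // -ltnS.
Qed.

Section Subchain.
Variables (R : realType) (G : lie_groupoid R) (E : graded_vbundle (objects G)).
Variables (p q n : nat) (g : chain G n) (a : order_map q n) (b : order_map p q).

Lemma lcochain_subchain L (c : lcochains E L) j
    (y : decoration L (subchain g (order_comp a b))) :
  c p j (subchain (subchain g a) b) y = c p j (subchain g (order_comp a b)) y.
Proof. exact: (lcochain_irrelevant c). Qed.

Lemma ruth_op_comp (rho : ruth_operators E) m m'
    (v : E m (chain_src (subchain g (order_comp a b)))) :
  rho p (subchain (subchain g a) b) m m' v =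
  rho p (subchain g (order_comp a b)) m m' v.
Proof. exact: (ruth_op_irrelevant rho). Qed.

End Subchain.

Definition prod_type (R : realType) (G : lie_groupoid R)
  (L1 L2 : objects G -> Type) (x : objects G) : Type := (L1 x * L2 x)%type.

Section Prism.
Variables (R : realType) (G : lie_groupoid R) (E : graded_vbundle (objects G)).
Variables (L : objects G -> Type) (rho : ruth E).

Definition mix p n (g : chain G n) (y : decoration (prod_type L L) g)
    (a : order_map p n) (b : 'I_p.+1 -> bool) : decoration L (subchain g a) :=
  fun i => if b i then (y (a i)).1 else (y (a i)).2.

(* The k-th summand inserts the edge from (x_k, y_k) to (x_k, z_k), which is a unit
   of G: by (RH1) the tails R_m through this edge vanish, except for m = 1. *)
Definition prism (c : lcochains E L) : lcochains E (prod_type L L) := fun i j g y =>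
  (-1 : R) ^ (i%:Z + j) *: \sum_(k < i.+1) (-1) ^+ k *:
    cast (chain_tgt g) (c i.+1 j (subchain g (sigma_map k))
      (mix y (sigma_map k) (fun l => (l <= k)%N))).

Section Identity.
Variables (c : lcochains E L) (n : nat) (g : chain G n) (y : decoration (prod_type L L) g).

Arguments c : clear implicits.

(* c on the simplex with vertices f 0, ..., f p of g, the i-th one being decorated
   by the first component of y if b i and by the second one otherwise. *)
Definition vertex_value p J (f : nat -> nat) (b : nat -> bool) x : E (- J) x :=
  cast x (c p J (subchain g (mono_map p n f)) (mix y (mono_map p n f) (fun i => b i))).

Lemma vertex_valueE p J (a : order_map p n) (s : 'I_p.+1 -> bool)
    (f : nat -> nat) (b : nat -> bool) x :
  (forall i, a i = f i :> nat) -> (forall i, s i = b i) ->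
  cast x (c p J (subchain g a) (mix y a s)) = vertex_value p J f b x.
Proof.
move=> /mono_mapE <- sb; have -> // : s = (fun i => b i).
exact/funext.
Qed.

Definition op_value m j J (t : nat -> nat) p (f : nat -> nat) (b : nat -> bool) :
    E (- j) (chain_tgt g) :=
  cast (chain_tgt g) (ruth_op rho m (subchain g (mono_map m n t)) (- J) (- j)
    (vertex_value p J f b (chain_src (subchain g (mono_map m n t))))).

Lemma op_valueE m j J (u : order_map m n) p (a : order_map p n)
    (s : 'I_p.+1 -> bool) (t f : nat -> nat) (b : nat -> bool) :
  (forall i, u i = t i :> nat) -> (forall i, a i = f i :> nat) ->
  (forall i, s i = b i) ->
  cast (chain_tgt g) (ruth_op rho m (subchain g u) (- J) (- j)
    (cast (chain_src (subchain g u)) (c p J (subchain g a) (mix y a s)))) =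
  op_value m j J t p f b.
Proof.
by move=> /mono_mapE <- af sb; rewrite (vertex_valueE _ _ af sb).
Qed.

Lemma prism_subchain p J (a : order_map p n) (f : nat -> nat) x :
  (forall i, a i = f i :> nat) ->
  cast x (prism c J (subdecoration a y)) =
  (-1 : R) ^ (p%:Z + J) *: \sum_(k < p.+1) (-1) ^+ k *:
    vertex_value p.+1 J (f \o unbump k) (fun i => (i <= k)%N) x.
Proof.
move=> af; rewrite /prism linearZ linear_sum /=; congr (_ *: _).
apply: eq_bigr => k _; rewrite linearZ /=; congr (_ *: _).
rewrite cast_trans; last first.
  congr (obj g (a _)); apply: val_inj => /=; rewrite /unbump.
  by have := ltn_ord k; lia.
rewrite -(@vertex_valueE _ _ (order_comp a (sigma_map k)) (fun i => (i <= k)%N)) //.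
  by rewrite (lcochain_subchain c).
by move=> i; rewrite /= af.
Qed.

Lemma coboundary_op_prism m (h : (m <= n)%N) j :
  lcoboundary_op rho h (prism c) j y =
  (-1 : R) ^ (j + m%:Z - 1) *: ((-1 : R) ^ ((n - m)%N%:Z + (j + m%:Z - 1)) *:
    \sum_(k < (n - m).+1) (-1) ^+ k *:
      op_value m j (j + m%:Z - 1) (addn (n - m)) (n - m).+1
        (unbump k) (fun i => (i <= k)%N)).
Proof.
rewrite lcoboundary_opE; congr (_ *: _).
rewrite (prism_subchain _ _ _ (f := id)) //.
rewrite linearZ /= linearZ /=; congr (_ *: _).
rewrite linear_sum /= linear_sum /=; apply: eq_bigr => k _.
rewrite linearZ /= linearZ /=; congr (_ *: _).
by rewrite /op_value (@mono_mapE _ _ (tau_map h)).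
Qed.

Lemma prism_coboundary_op_nondegenerate m (h : (m <= n.+1)%N) j (k : 'I_n.+1) :
  (m + k <= n)%N ->
  cast (chain_tgt g)
    (lcoboundary_op rho h c j (mix y (sigma_map k) (fun l => (l <= k)%N))) =
  (-1 : R) ^ (j + m%:Z - 1) *: op_value m j (j + m%:Z - 1) (addn (n - m)) (n - m).+1
        (unbump k) (fun i => (i <= k)%N).
Proof.
move=> mk; rewrite lcoboundary_opE linearZ /=; congr (_ *: _).
rewrite cast_trans; last first.
  by congr (obj g _); apply: val_inj => /=; congr (unbump _ _); rewrite /= subnK.
rewrite (@ruth_op_comp _ _ _ _ _ _ g (sigma_map k) (tau_map h) (ruth_op rho)).
rewrite (lcochain_subchain c).
rewrite (_ : (n - m).+1 = (n.+1 - m)%N); last by lia.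
rewrite -(@op_valueE m j _ (order_comp (sigma_map k) (tau_map h)) _
   (order_comp (sigma_map k) (iota_map (leq_subr m n.+1))) (fun i => (i <= k)%N)) //.
by move=> i /=; rewrite /unbump; lia.
Qed.

Lemma prism_coboundary_op_degenerate m (h : (m <= n.+1)%N) j (k : 'I_n.+1) :
  (n < m + k)%N ->
  cast (chain_tgt g)
    (lcoboundary_op rho h c j (mix y (sigma_map k) (fun l => (l <= k)%N))) =
  if m == 1%N then (-1 : R) ^ j *: vertex_value n j id (fun=> true) (chain_tgt g)
  else 0.
Proof.
move=> mk; rewrite lcoboundary_opE linearZ /=.
rewrite cast_trans; last first.
  by congr (obj g _); apply: val_inj => /=; congr (unbump _ _); rewrite /= subnK.
rewrite (@ruth_op_comp _ _ _ _ _ _ g (sigma_map k) (tau_map h) (ruth_op rho)).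
rewrite (lcochain_subchain c).
have kn := ltn_ord k.
have i0 : (k - (n.+1 - m) < m.+1)%N by lia.
have i1 : ((k - (n.+1 - m)).+1 < m.+1)%N by lia.
have dg : degenerate (subchain g (order_comp (sigma_map k) (tau_map h))).
  apply: (@degenerate_subchain _ _ _ _ _ _ (Ordinal i0) (Ordinal i1)) => //.
  by apply: val_inj => /=; rewrite /unbump; lia.
have [rh1 rh1'] : ruth_RH1 (ruth_op rho) by case: (ruth_opP rho).
case: ifPn => [/eqP m1|m1]; last first.
  rewrite rh1' ?linear0 ?scaler0 //; lia.
subst m; move: (j + 1%:Z - 1) (addrK 1%:Z j) => J e; subst J; congr (_ *: _).
rewrite (rh1 _ dg) -castE !cast_trans //; last first.
- by rewrite /chain_tgt /=; congr (obj g _); apply: val_inj; rewrite /= /unbump; lia.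
- by congr (obj g _); apply: val_inj => /=; rewrite addn0.
transitivity (vertex_value (n.+1 - 1) j id xpredT (chain_tgt g)); last first.
  by rewrite subn1.
rewrite -(@vertex_valueE _ _ (order_comp (sigma_map k) (iota_map (leq_subr 1 n.+1)))
   (fun i => (i <= k)%N)) //.
- by move=> i /=; have := ltn_ord i; rewrite /unbump; lia.
- by move=> i /=; have := ltn_ord i; lia.
Qed.

Lemma prism_coboundary_faces j (k : 'I_n.+1) :
  cast (chain_tgt g)
    (lcoboundary_faces c j (mix y (sigma_map k) (fun l => (l <= k)%N))) =
  (-1 : R) ^ (n%:Z + j + 1) *: \sum_(r < n.+1) (-1) ^+ r *:
    vertex_value n j (unbump k \o bump r) (fun i => (bump r i <= k)%N)
      (chain_tgt g).
Proof.
rewrite lcoboundary_facesE linearZ linear_sum /=; congr (_ *: _).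
apply: eq_bigr => r _; rewrite linearZ /=; congr (_ *: _).
rewrite cast_trans; last first.
  congr (obj g _); apply: val_inj => /=; congr (unbump _ _) => /=.
  by rewrite /bump; have := ltn_ord r; lia.
rewrite (lcochain_subchain c).
by rewrite -(@vertex_valueE _ _ (order_comp (sigma_map k)
  (delta_map (widen_ord (leqnSn n.+1) r))) (fun i => (bump r i <= k)%N)).
Qed.

Definition order_id p : order_map p p := @OrderMap p p (fun i => i) (fun i j h => h).

Lemma vertex_value_id j (b : bool) :
  vertex_value n j id (fun=> b) (chain_tgt g) =
  c n j g (fun i => if b then (y i).1 else (y i).2).
Proof.
rewrite -(@vertex_valueE _ _ (order_id n) (fun=> b)) //.
rewrite (castE (erefl (chain_tgt g))) /= /mix /=.
move: y; case: (g) => ob ar P y'.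
exact: (@lcochain_irrelevant _ _ _ _ c n ob ar
  (chainP (subchain (Chain P) (order_id n))) P j).
Qed.

Lemma vertex_value_ext p J (f f' : nat -> nat) (b b' : nat -> bool) x :
  (forall i, (i <= p)%N -> f i = f' i) -> (forall i, (i <= p)%N -> b i = b' i) ->
  vertex_value p J f b x = vertex_value p J f' b' x.
Proof.
move=> ff bb; rewrite /vertex_value.
have -> : mono_map p n f = mono_map p n f'.
  apply: order_map_ext => i; apply: val_inj => /=; congr (val (inord (minn n _))).
  apply: eq_bigr => l _; apply: ff.
  by have := ltn_ord l; have := ltn_ord i; lia.
have -> // : (fun i : 'I_p.+1 => b i) = (fun i => b' i).
by apply/funext => i; apply: bb; rewrite -ltnS.
Qed.

End Identity.

Lemma signzS (a : int) : (-1 : R) ^ (a + 1) = - (-1 : R) ^ a.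
Proof. by rewrite expfzDr ?oppr_eq0 ?oner_eq0 // mulrN1. Qed.

Lemma signz_sqr (a : int) : (-1 : R) ^ a * (-1 : R) ^ a = 1.
Proof. by rewrite -expfzMl mulN1r opprK exp1rz. Qed.

Lemma coboundary_faces_prism c n (g : chain G n) (y : decoration (prod_type L L) g) j :
  lcoboundary_faces (prism c) j y =
  - \sum_(k < n) \sum_(r < n) (-1) ^+ (k + r) *:
      vertex_value c y n j (bump r \o unbump k) (fun i => (i <= k)%N)
        (chain_tgt g).
Proof.
case: n g y => [|n] g y; first by rewrite big_ord0 oppr0.
rewrite lcoboundary_facesE exchange_big -sumrN scaler_sumr; apply: eq_bigr => r _.
rewrite (prism_subchain _ _ _ _ (f := bump r)) // scaler_sumr -sumrN.
rewrite scaler_sumr scaler_sumr.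
apply: eq_bigr => k _; rewrite !scalerA exprD signzS -scaleNr; congr (_ *: _).
rewrite !mulNr; congr (- _).
rewrite [LHS](_ : _ =
  ((-1 : R) ^ (n%:Z + j) * (-1) ^ (n%:Z + j)) * ((-1) ^+ k * (-1) ^+ r)).
  by rewrite signz_sqr mul1r.
by ring.
Qed.

Lemma prism_homotopy c n j (g : chain G n) (y : decoration (prod_type L L) g) :
  lcoboundary rho (prism c) j y + prism (lcoboundary rho c) j y =
  c n j g (fun i => (y i).1) - c n j g (fun i => (y i).2).
Proof.
pose T m k := op_value c y m j (j + m%:Z - 1) (addn (n - m)) (n - m).+1
  (unbump k) (fun i => (i <= k)%N).
pose s := (-1 : R) ^ (n%:Z + j).
pose Y := vertex_value c y n j id xpredT (chain_tgt g).
pose a k r := vertex_value c y n j (unbump k \o bump r) (fun i => (bump r i <= k)%N)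
  (chain_tgt g).
pose b r k := vertex_value c y n j (bump r \o unbump k) (fun i => (i <= k)%N)
  (chain_tgt g).
pose TT m k := if (m + k <= n)%N then (-1 : R) ^ (j + m%:Z - 1) *: T m k else 0.
have E1 : \sum_(m < n.+1) lcoboundary_op rho (leq_ord m) (prism c) j y =
    - (s *: \sum_(k < n.+1) (-1) ^+ k *: \sum_(m < n.+1) TT m k).
  rewrite scaler_sumr.
  under [in RHS]eq_bigr => k _ do rewrite !scaler_sumr.
  rewrite exchange_big -sumrN; apply: eq_bigr => m _.
  rewrite coboundary_op_prism -sumrN.
  rewrite (big_ord_widen n.+1 (fun k => (-1) ^+ k *: T m k)); last first.
    by have := ltn_ord m; lia.
  rewrite big_mkcond !scaler_sumr; apply: eq_bigr => k _.
  rewrite /TT (_ : (k < (n - m).+1)%N = (m + k <= n)%N); last first.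
    by have := ltn_ord m; lia.
  case: ifP => mk; last by rewrite !scaler0 oppr0.
  rewrite !scalerA -scaleNr; congr (_ *: _).
  have -> : (n - m)%N%:Z + (j + m%:Z - 1) = n%:Z + j - 1.
    rewrite -subzn; last by have := ltn_ord m; lia.
    by ring.
  have -> : s = - (-1) ^ (n%:Z + j - 1) by rewrite /s -signzS subrK.
  by ring.
have E2 k : cast (chain_tgt g) (\sum_(m < n.+2) lcoboundary_op rho (leq_ord m) c j
      (mix y (sigma_map k) (fun l => (l <= k)%N))) =
    \sum_(m < n.+1) TT m k + (if k == n :> nat then (-1 : R) ^ j *: Y else 0).
  rewrite linear_sum /=.
  rewrite (eq_bigr (fun m : 'I_n.+2 => TT m k + (if m == 1%N :> nat then
      (if k == n :> nat then (-1 : R) ^ j *: Y else 0) else 0))); last first.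
    move=> m _; rewrite /TT; case: leqP => mk.
      rewrite prism_coboundary_op_nondegenerate //.
      case: eqP => [m1|_]; last by rewrite addr0.
      by rewrite ifF ?addr0 //; apply/negbTE/eqP; lia.
    rewrite prism_coboundary_op_degenerate // add0r; case: eqP => // m1.
    by rewrite ifT //; apply/eqP; have := ltn_ord k; lia.
  rewrite big_split /= big_ord_recr /= {2}/TT ifF ?addr0; last by apply/negbTE; lia.
  congr (_ + _).
  have i1 : (1 < n.+2)%N by [].
  rewrite (bigD1 (Ordinal i1)) //= big1 ?addr0 // => m /negbTE.
  by rewrite -val_eqE /= => ->.
have E3 : prism (lcoboundary rho c) j y =
    s *: (\sum_(k < n.+1) (-1) ^+ k *: \sum_(m < n.+1) TT m k) + Y -
    \sum_(k < n.+1) \sum_(r < n.+1) (-1) ^+ (k + r) *: a k r.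
  rewrite /prism -/s; under eq_bigr => k _.
    rewrite [X in cast _ X]/(lcoboundary rho c j _) linearD /= E2.
    rewrite prism_coboundary_faces -addrA scalerDr scalerDr.
    over.
  rewrite !big_split /= scalerDr scalerDr addrA; congr (_ + _ + _).
    rewrite big_ord_recr /= big1 ?add0r => [|k _]; last first.
      by rewrite ifF ?scaler0 //; apply/negbTE/eqP; have := ltn_ord k; lia.
    rewrite eqxx !scalerA -[RHS]scale1r; congr (_ *: _).
    rewrite exprnP /s expfzDr ?oppr_eq0 ?oner_eq0 //.
    rewrite [LHS](_ : _ = ((-1 : R) ^ n%:Z * (-1) ^ n%:Z) * ((-1) ^ j * (-1) ^ j)).
      by rewrite !signz_sqr mul1r.
    by ring.
  rewrite scaler_sumr -sumrN; apply: eq_bigr => k _.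
  rewrite !scaler_sumr -sumrN; apply: eq_bigr => r _.
  rewrite !scalerA -scaleNr; congr (_ *: _); rewrite signzS exprD.
  rewrite [LHS](_ : _ = - ((s * s) * ((-1) ^+ k * (-1) ^+ r))); last by rewrite /s; ring.
  by rewrite /s signz_sqr mul1r.
pose N k := vertex_value c y n j id (fun i => (i < k)%N) (chain_tgt g).
have H : \sum_(k < n.+1) \sum_(r < n.+1) (-1) ^+ (k + r) *: a k r +
    \sum_(k < n) \sum_(r < n) (-1) ^+ (k + r) *: b r k = N 0%N.
  apply: prism_face_sum => [k kn|k kn|k r rk kn|k r kr rn];
    by apply: vertex_value_ext => i ip; rewrite /= /bump /unbump; lia.
have N0 : N 0%N = c n j g (fun i => (y i).2).
  by rewrite -(vertex_value_id c y j false).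
have Y1 : Y = c n j g (fun i => (y i).1) by rewrite -(vertex_value_id c y j true).
rewrite {1}/lcoboundary E1 E3 coboundary_faces_prism -Y1 -N0 -H.
rewrite opprD (AC (2*(2*1)) ((1*3)*(4*(5*2)))) /=.
by rewrite addNr add0r.
Qed.

End Prism.

(** * Averaging over choices of lifts *)

Section FiniteSums.

Lemma ffun_sum_widen (V : nmodType) n K K' (F : ('I_n -> nat) -> V) : (K <= K')%N ->
  (forall f k, (K < f k)%N -> F f = 0) ->
  \sum_(f : {ffun 'I_n -> 'I_K'.+1}) F (fun k => f k) =
  \sum_(f : {ffun 'I_n -> 'I_K.+1}) F (fun k => f k).
Proof.
move=> KK F0; pose P (f : {ffun 'I_n -> 'I_K'.+1}) := [forall k, (f k <= K)%N].
rewrite (bigID P) /= [X in _ + X]big1 ?addr0; last first.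
  by move=> f; rewrite negb_forall => /existsP[k]; rewrite -ltnNge; exact: F0.
have KK1 : (K.+1 <= K'.+1)%N by [].
rewrite (reindex_onto (fun f : {ffun 'I_n -> 'I_K.+1} =>
    [ffun k => widen_ord KK1 (f k)])
  (fun f : {ffun 'I_n -> 'I_K'.+1} => [ffun k => inord (f k)])) /=.
  apply: eq_big => [f|f _].
    apply/andP; split; first by apply/forallP => k; rewrite ffunE /= -ltnS.
    by apply/eqP/ffunP => k; rewrite !ffunE /= inord_val.
  by congr F; apply/funext => k; rewrite ffunE.
move=> f /forallP fK; apply/ffunP => k; rewrite !ffunE; apply: val_inj => /=.
by rewrite inordK // ltnS.
Qed.

Lemma ffun_sum_marginal (R : comPzRingType) (V : lmodType R) (I J A : finType)
    (t : I -> J) (w : J -> A -> R) (F : (I -> A) -> V) :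
  injective t -> (forall j, \sum_a w j a = 1) ->
  \sum_(f : {ffun J -> A}) (\prod_j w j (f j)) *: F (fun i => f (t i)) =
  \sum_(f : {ffun I -> A}) (\prod_i w (t i) (f i)) *: F (fun i => f i).
Proof.
move=> tinj w1.
rewrite (partition_big (fun f : {ffun J -> A} => [ffun i => f (t i)]) xpredT) //=.
apply: eq_bigr => h _.
pose Q j a := [forall i, (t i == j) ==> (a == h i)].
rewrite (eq_bigr (fun f : {ffun J -> A} =>
  (\prod_j w j (f j)) *: F (fun i => h i))); last first.
  by move=> f /eqP <-; congr (_ *: F _); apply/funext => i; rewrite ffunE.
rewrite -scaler_suml; congr (_ *: _).
transitivity (\sum_(f in family Q) \prod_j w j (f j)).
  apply: eq_bigl => f; apply/eqP/familyP => [fh j|fQ].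
    by rewrite unfold_in; apply/forallP => i; apply/implyP => /eqP <-; rewrite -fh ffunE.
  apply/ffunP => i; rewrite ffunE; have := fQ (t i); rewrite unfold_in.
  by move=> /forallP/(_ i); rewrite eqxx => /eqP.
rewrite -(bigA_distr_big_dep Q (fun j a => w j a)) /=.
rewrite (bigID (fun j => j \in t @: I)) /= [X in _ * X]big1 ?mulr1; last first.
  move=> j jt; rewrite -[RHS](w1 j); apply: eq_bigl => a.
  apply/forallP => i; apply/implyP => /eqP ij; move: jt.
  by rewrite -ij imset_f.
rewrite big_imset /=; last by move=> i i' _ _; exact: tinj.
apply: eq_big => // i _.
rewrite (big_pred1 (h i)) // => a; apply/forallP/eqP => [/(_ i)|-> i'].
  by rewrite eqxx => /eqP.
by apply/implyP => /eqP/tinj ->.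
Qed.

End FiniteSums.

Section Average.
Variables (R : realType) (G : lie_groupoid R) (E : graded_vbundle (objects G)).
Variables (L1 L2 : objects G -> Type) (rho : ruth E).
Variables (w : nat -> objects G -> R) (s : nat -> forall x, L2 x).
Variable N : objects G -> nat.
Hypothesis w0 : forall x k, (N x <= k)%N -> w k x = 0.
Hypothesis w1 : forall x n, (forall k, (n <= k)%N -> w k x = 0) ->
  \sum_(k < n) w k x = 1.

Implicit Type C : lcochains E (prod_type L1 L2).

Definition chain_bound n (g : chain G n) : nat := \max_(k < n.+1) N (obj g k).

Definition weight n (g : chain G n) (f : 'I_n.+1 -> nat) : R :=
  \prod_k w (f k) (obj g k).

Definition label n (g : chain G n) (y : decoration L1 g) (f : 'I_n.+1 -> nat) :
  decoration (prod_type L1 L2) g := fun k => (y k, s (f k) (obj g k)).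

(* The mean of C over all choices of labels k_0, ..., k_i in the partition of unity,
   weighted by w_(k_0)(x_0) ... w_(k_i)(x_i); labels above chain_bound g do not
   contribute. *)
Definition average C : lcochains E L1 := fun i j g y =>
  \sum_(f : {ffun 'I_i.+1 -> 'I_(chain_bound g).+1})
    weight g (fun k => f k) *: C i j g (label y (fun k => f k)).

Lemma averageE C i j (g : chain G i) (y : decoration L1 g) K :
  (chain_bound g <= K)%N ->
  average C j y = \sum_(f : {ffun 'I_i.+1 -> 'I_K.+1})
    weight g (fun k => f k) *: C i j g (label y (fun k => f k)).
Proof.
move=> gK; apply/esym.
apply: (@ffun_sum_widen _ _ _ _ (fun f => weight g f *: C i j g (label y f))) => //.
move=> f k fk; rewrite /weight (bigD1 k) //= w0 ?mul0r ?scale0r //.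
by apply: leq_trans (ltnW fk); exact: (leq_bigmax k).
Qed.

Lemma w_sum1 x K : (N x <= K)%N -> \sum_(k < K.+1) w k x = 1.
Proof. by move=> xK; apply: w1 => k Kk; apply: w0; apply: leq_trans xK (ltnW Kk). Qed.

(* The weights of the vertices not in the face sum to 1. *)
Lemma average_subchain C p n (g : chain G n) (a : order_map p n) j
    (y : decoration L1 g) : injective a ->
  average C j (subdecoration a y) =
  \sum_(f : {ffun 'I_n.+1 -> 'I_(chain_bound g).+1})
    weight g (fun k => f k) *:
    C p j (subchain g a) (subdecoration a (label y (fun k => f k))).
Proof.
move=> ainj; rewrite (@averageE _ _ _ _ _ (chain_bound g)); last first.
  by apply/bigmax_leqP => k _; exact: (leq_bigmax (a k)).
rewrite -(@ffun_sum_marginal _ _ _ _ _ a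
  (fun k (l : 'I_(chain_bound g).+1) => w l (obj g k))
  (fun f => C p j (subchain g a) (label (subdecoration a y) (fun i => f i)))) //.
by move=> k; apply: w_sum1; exact: (leq_bigmax k).
Qed.

Lemma average_coboundary C n j (g : chain G n) (y : decoration L1 g) :
  lcoboundary rho (average C) j y = average (lcoboundary rho C) j y.
Proof.
rewrite /average /lcoboundary -/(average C).
under [in RHS]eq_bigr => f _ do rewrite scalerDr scaler_sumr.
rewrite big_split /= exchange_big; congr (_ + _).
  apply: eq_bigr => m _; rewrite lcoboundary_opE average_subchain; last first.
    by move=> i i' /(congr1 val) /= ii; apply: val_inj.
  rewrite linear_sum /= linear_sum /= linear_sum scaler_sumr; apply: eq_bigr => f _.
  rewrite lcoboundary_opE linearZ /= linearZ /= linearZ /= !scalerA.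
  by congr (_ *: _); rewrite mulrC.
case: n g y => [|n] g y; first by rewrite big1 // => f _; rewrite scaler0.
rewrite lcoboundary_facesE.
under [in RHS]eq_bigr => f _ do
  rewrite lcoboundary_facesE scalerA mulrC -scalerA scaler_sumr.
rewrite -scaler_sumr exchange_big; congr (_ *: _); apply: eq_bigr => r _.
rewrite average_subchain; last first.
  exact: lift_inj.
rewrite linear_sum /= scaler_sumr; apply: eq_bigr => f _.
by rewrite linearZ /= !scalerA; congr (_ *: _); rewrite mulrC.
Qed.

Lemma sum_weight n (g : chain G n) :
  \sum_(f : {ffun 'I_n.+1 -> 'I_(chain_bound g).+1}) weight g (fun k => f k) = 1.
Proof.
rewrite -(bigA_distr_bigA (fun k (l : 'I_(chain_bound g).+1) => w l (obj g k))).
by rewrite big1 // => k _; apply: w_sum1; exact: (leq_bigmax k).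
Qed.

End Average.

(** * Chains of a hypercover *)

Section ChainEq.
Variables (R : realType) (G : lie_groupoid R).

Lemma chain_ext n (ob : 'I_n.+1 -> objects G)
    (ar ar' : forall i j : 'I_n.+1, (i <= j)%N -> arrows G)
    (p : chain_axiom ob ar) (p' : chain_axiom ob ar') :
  (forall i j ij, ar i j ij = ar' i j ij) -> Chain p = Chain p'.
Proof.
move=> H; have e : ar = ar' by do 3 (apply: functional_extensionality_dep => ?).
by subst ar'; rewrite (Prop_irrelevance p p').
Qed.

End ChainEq.

Section Lift.
Variables (R : realType) (G' G : lie_groupoid R) (phi : groupoid_morphism G' G).
Variable h : hypercover_fp phi -> arrows G'.
Hypothesis hK : cancel (hypercover_fp_map phi) h.
Hypothesis Kh : cancel h (hypercover_fp_map phi).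

Lemma hypercover_fp_ext (a b : hypercover_fp phi) :
  fp_tgt a = fp_tgt b -> fp_src a = fp_src b -> fp_arrow a = fp_arrow b -> a = b.
Proof.
case: a b => [t s a p q] [t' s' a' p' q'] /= et es ea.
subst t' s' a'; by rewrite (Prop_irrelevance p p') (Prop_irrelevance q q').
Qed.

Lemma arrow_ext (a b : arrows G') : tgt a = tgt b -> src a = src b ->
  on_arrows phi a = on_arrows phi b -> a = b.
Proof.
by move=> et es ea; rewrite -(hK a) -(hK b); congr h; exact: hypercover_fp_ext.
Qed.

Lemma tgt_fp (q : hypercover_fp phi) : tgt (h q) = fp_tgt q.
Proof. by rewrite -[in RHS](Kh q). Qed.

Lemma src_fp (q : hypercover_fp phi) : src (h q) = fp_src q.
Proof. by rewrite -[in RHS](Kh q). Qed.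

Lemma on_arrows_fp (q : hypercover_fp phi) : on_arrows phi (h q) = fp_arrow q.
Proof. by rewrite -[in RHS](Kh q). Qed.

Definition object_lift (x : objects G) : Type := {x' | on_objects phi x' = x}.

Section LiftChain.
Variables (n : nat) (g : chain G n) (y : decoration object_lift g).

Lemma lift_tgt_subproof (i j : 'I_n.+1) (ij : (i <= j)%N) :
  on_objects phi (sval (y j)) = tgt (arr g ij).
Proof. by have [ends _ _] := chainP g; rewrite (ends _ _ ij).2 (svalP (y j)). Qed.

Lemma lift_src_subproof (i j : 'I_n.+1) (ij : (i <= j)%N) :
  on_objects phi (sval (y i)) = src (arr g ij).
Proof. by have [ends _ _] := chainP g; rewrite (ends _ _ ij).1 (svalP (y i)). Qed.

Definition lift_fp (i j : 'I_n.+1) (ij : (i <= j)%N) : hypercover_fp phi :=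
  HypercoverFP (lift_tgt_subproof ij) (lift_src_subproof ij).

Lemma lift_chain_subproof :
  chain_axiom (fun i => sval (y i)) (fun i j ij => h (lift_fp ij)).
Proof.
have [ends unit comp] := chainP g; split=> [i j ij|i ii|i j k ij jk ik].
- by rewrite src_fp tgt_fp.
- apply: arrow_ext; rewrite ?tgt_fp ?src_fp ?tgt_unit ?src_unit //.
  by rewrite on_arrows_fp /= unit morphism_unit (svalP (y i)).
- have c : src (h (lift_fp jk)) = tgt (h (lift_fp ij)) by rewrite src_fp tgt_fp.
  apply: arrow_ext; rewrite ?tgt_mul ?src_mul ?tgt_fp ?src_fp //.
  by rewrite morphism_mul // !on_arrows_fp /=; exact: comp.
Qed.

Definition lift_chain : chain G' n := Chain lift_chain_subproof.

End LiftChain.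

Definition canonical_lift n (g : chain G' n) :
    decoration object_lift (chain_map phi g) :=
  fun k => exist _ (obj g k) erefl.

Lemma canonical_lift_ind n (P : forall g : chain G n, decoration object_lift g -> Prop) :
  (forall g' : chain G' n, P (chain_map phi g') (canonical_lift g')) ->
  forall g y, P g y.
Proof.
move=> H [ob ar p] y.
pose ob' k := sval (y k); pose pf k : on_objects phi (ob' k) = ob k := svalP (y k).
have -> : y = fun k => exist _ (ob' k) (pf k).
  apply: functional_extensionality_dep => k.
  move: (pf k); rewrite /ob'; case: (y k) => x e e'.
  by rewrite (Prop_irrelevance e e').
move: ob' pf => ob' pf {y}.
have e : (fun k => on_objects phi (ob' k)) = ob by exact/funext.
case: _ / e in ar p pf *.
have -> : pf = fun=> erefl.
  by apply: functional_extensionality_dep => k; exact: Prop_irrelevance.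
pose y : decoration object_lift (Chain p) := fun k => exist _ (ob' k) erefl.
have := H (lift_chain y); rewrite /chain_map.
move: (chain_pullback_subproof _ _) => q; rewrite /= in q *.
have E : ar = fun i j ij => on_arrows phi (h (lift_fp y ij)).
  by do 3 (apply: functional_extensionality_dep => ?); rewrite on_arrows_fp.
by rewrite /canonical_lift /=; move: q; rewrite -E => q; rewrite (Prop_irrelevance p q).
Qed.

Variable E : graded_vbundle (objects G).
Local Notation E' := (graded_pullback phi E).

Definition lift_cochain (c : cochains E') : lcochains E object_lift :=
  fun i j g y => cast (chain_tgt g) (c i j (lift_chain y) : E (- j) _).

Definition restrict_cochain (C : lcochains E object_lift) : cochains E' :=
  fun i j g => C i j (chain_map phi g) (canonical_lift g).

Lemma lift_canonical n (g : chain G' n) : lift_chain (canonical_lift g) = g.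
Proof.
case: g => ob ar p; apply: chain_ext => i j ij /=.
have [ends _ _] := p; have [es et] := ends i j ij.
by apply: arrow_ext; rewrite ?tgt_fp ?src_fp ?on_arrows_fp /= ?es ?et.
Qed.

Lemma restrict_lift_cochain (c : cochains E') :
  restrict_cochain (lift_cochain c) = c.
Proof.
apply: cochainsP => i j g; rewrite /restrict_cochain /lift_cochain.
by rewrite (lift_canonical g) /= cast_id.
Qed.

Variable rho : ruth E.

Lemma restrict_coboundary (C : lcochains E object_lift) :
  coboundary (ruth_pullback phi rho) (restrict_cochain C) =
  restrict_cochain (lcoboundary rho C).
Proof.
apply: cochainsP => k j g; rewrite /coboundary /restrict_cochain.
refine (congr2 +%R _ _).
  apply: eq_bigr => m _; rewrite /coboundary_op; refine (congr1 ( *:%R _) _).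
  rewrite (transport_pullback _ (chain_tgt_tau (leq_ord m) (chain_map phi g))).
  rewrite (transport_pullback _ (chain_cut (leq_subr m k) (leq_ord m)
    (chain_map phi g) (subnK (leq_ord m)))).
  refine (esym (congr1 (transport _ _) (etrans _ (ruth_op_subchain (ruth_op rho) _ _)))).
  refine (congr1 (ruth_op _ _ _ _ _) (congr1 (transport _ _) _)).
  exact: (lcochain_irrelevant C).
case: k g => [|i] g //=; refine (congr1 ( *:%R _) _).
apply: eq_bigr => r _; refine (congr1 ( *:%R _) _).
rewrite (transport_pullback _ (chain_tgt_delta (chain_map phi g) (outer_vertex_lt r))).
refine (congr1 (transport _ _) _).
exact: (lcochain_irrelevant C).
Qed.

Lemma lcochainsP (L : objects G -> Type) (C D : lcochains E L) :
  (forall i j g y, C i j g y = D i j g y) -> C = D.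
Proof. by move=> CD; do 4 (apply: functional_extensionality_dep => ?). Qed.

Lemma restrict_cochain_inj : injective restrict_cochain.
Proof.
move=> C D CD; apply: lcochainsP => i j.
apply: canonical_lift_ind => g.
exact: (congr1 (fun c : cochains E' => c i j g) CD).
Qed.

Lemma lcoboundary_lift (c : cochains E') :
  lcoboundary rho (lift_cochain c) =
  lift_cochain (coboundary (ruth_pullback phi rho) c).
Proof.
by apply: restrict_cochain_inj; rewrite -restrict_coboundary !restrict_lift_cochain.
Qed.

Lemma lift_cochain_pullback (c : cochains E) :
  lift_cochain (cochain_pullback phi c) = (fun i j g _ => c i j g).
Proof. by apply: restrict_cochain_inj; rewrite restrict_lift_cochain. Qed.

End Lift.

(** * Descent of cochains *)

Section SmoothAverage.
Variable R : realType.

Lemma plot_ext (M : manifold R) k (U : set 'rV[R]_k) (p q : 'rV[R]_k -> M) :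
  open U -> (forall u, U u -> p u = q u) -> plot U p -> plot U q.
Proof.
move=> oU pq [cp sp]; split=> [u Uu|c ac r].
  move=> B; rewrite -(pq u Uu) => /(cp u Uu) nB.
  have nB' : nbhs u (p @^-1` B) := nB.
  rewrite -[nbhs _ _]/(nbhs u (q @^-1` B)).
  have nU : nbhs u U by exact: open_nbhs_nbhs.
  by apply: filterS2 nU nB' => v /= /pq <-.
have -> : U `&` q @^-1` chart_dom c = U `&` p @^-1` chart_dom c.
  by apply/seteqP; split=> u [Uu] /=; rewrite ?pq // => cu; split => //=; rewrite pq.
apply: (@diff_class_ext _ _ _ _ _ (chart_map c \o p)) (sp c ac r).
  by apply: plot_open => //; exact: chart_dom_open.
by move=> u [Uu _] /=; rewrite pq.
Qed.

Lemma diff_class_scaler (V : normedModType R) m k (U : set V) (f : V -> R)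
    (F : V -> 'rV[R]_m) : open U -> diff_class k U f -> diff_class k U F ->
  diff_class k U (fun x => f x *: F x).
Proof.
move=> oU sf sF; apply: diff_class_row => // i.
apply: (@diff_class_ext _ _ _ _ _ (fun x => f x * F x 0 i)) => //.
  by move=> x _; rewrite mxE.
by apply: diff_classM => //; exact: diff_class_coord.
Qed.

Lemma triv_cast (M : manifold R) (E : vbundle M) (a : triv_index E) x y (v : E x) :
  x = y -> triv E a y (cast y v) = triv E a x v.
Proof. by move=> e; case: y / e; rewrite cast_id. Qed.

Variables (G : lie_groupoid R) (w : nat -> objects G -> R) (A : nat -> set (objects G)).
Hypothesis sw : forall k, plot_smooth (w k).
Hypothesis oA : forall k, open (A k).
Hypothesis wA : forall k x, ~ A k x -> \forall y \near x, w k y = 0.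

Lemma weight_smooth n k (U : set 'rV[R]_k) (p : 'rV[R]_k -> chain G n)
    (f : 'I_n.+1 -> nat) : open U -> chain_plot U p ->
  smooth U (fun u => weight w (p u) f).
Proof.
move=> oU [pp _] r; apply: diff_class_prod => // l.
exact: (sw (f l) oU (pp l)).
Qed.

Lemma weighted_smooth n m k (U : set 'rV[R]_k) (p : 'rV[R]_k -> chain G n)
    (f : 'I_n.+1 -> nat) (F : 'rV[R]_k -> 'rV[R]_m) :
  open U -> chain_plot U p ->
  (forall U', open U' -> U' `<=` U ->
    (forall u, U' u -> forall l, A (f l) (obj (p u) l)) -> smooth U' F) ->
  smooth U (fun u => weight w (p u) f *: F u).
Proof.
move=> oU pp HF r; apply: diff_class_cover => u Uu.
have [Au|/existsNP[l nAl]] := pselect (forall l, A (f l) (obj (p u) l)).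
  have nA : \forall v \near u, forall l, A (f l) (obj (p v) l).
    apply: (filter_forall (nbhs_filter u)) => l.
    apply: ((pp.1 l).1 u Uu); apply: open_nbhs_nbhs; split=> //; exact: oA.
  have [U' [oU' U'u sU' U'A]] := open_near_setI oU Uu nA.
  exists U' => //; apply: diff_class_scaler => //.
    by apply: diff_class_sub (weight_smooth f oU pp r).
  exact: (HF U' oU' sU' U'A).
have n0 : \forall v \near u, w (f l) (obj (p v) l) = 0.
  exact: ((pp.1 l).1 u Uu _ (wA nAl)).
have [U' [oU' U'u sU' U'0]] := open_near_setI oU Uu n0.
exists U' => //; apply: (@diff_class_ext _ _ _ _ _ (fun=> 0)) => //.
  by move=> v /U'0 wv; rewrite /weight (bigD1 l) //= wv mul0r scale0r.
exact: diff_class_cst.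
Qed.

Variable N : objects G -> nat.
Hypothesis Nw : forall x, \forall y \near x, forall k, (N x <= k)%N -> w k y = 0.

Lemma weight_bound x k : (N x <= k)%N -> w k x = 0.
Proof. exact: nbhs_singleton (Nw x) k. Qed.

Variables (E : graded_vbundle (objects G)) (L1 L2 : objects G -> Type).
Variable s : nat -> forall x, L2 x.

Lemma average_smooth (C : lcochains E (prod_type L1 L2)) i j k (U : set 'rV[R]_k)
    (p : 'rV[R]_k -> chain G i) (y : forall u, decoration L1 (p u))
    (a : triv_index (E (- j))) : open U -> chain_plot U p ->
  (forall U' (f : 'I_i.+1 -> nat), open U' -> U' `<=` U ->
    (forall u, U' u -> forall l, A (f l) (obj (p u) l)) ->
    smooth U' (fun u => triv (E (- j)) a (chain_tgt (p u))
      (C i j (p u) (label s (y u) f)))) ->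
  smooth U (fun u => triv (E (- j)) a (chain_tgt (p u))
    (average w s N C j (y u))).
Proof.
move=> oU pp HC r; apply: diff_class_cover => u Uu.
have nN : \forall v \near u, forall l m, (N (obj (p u) l) <= m)%N ->
    w m (obj (p v) l) = 0.
  apply: (filter_forall (nbhs_filter u)) => l.
  exact: ((pp.1 l).1 u Uu _ (Nw _)).
have [U' [oU' U'u sU' U'N]] := open_near_setI oU Uu nN.
pose K := chain_bound N (p u).
exists U' => //; apply: (@diff_class_ext _ _ _ _ _ (fun v =>
   \sum_(f : {ffun 'I_i.+1 -> 'I_K.+1}) weight w (p v) (fun l => f l) *:
     triv (E (- j)) a (chain_tgt (p v)) (C i j (p v) (label s (y v) (fun l => f l))))) => //.
  move=> v /U'N vN.
  rewrite (averageE s weight_bound C j (y v) (leq_maxl (chain_bound N (p v)) K)).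
  rewrite (@ffun_sum_widen _ _ K _ (fun f => weight w (p v) f *:
     C i j (p v) (label s (y v) f))) ?leq_maxr //.
    rewrite linear_sum; apply: eq_bigr => f _; by rewrite linearZ.
  move=> f l fl; rewrite /weight (bigD1 l) //= vN ?mul0r ?scale0r //.
  by apply: leq_trans (ltnW fl); exact: (leq_bigmax l).
apply: diff_class_sum => // f; apply: weighted_smooth => //.
  by split=> [l|l m lm]; [exact: plot_sub (pp.1 l)|exact: plot_sub (pp.2 l m lm)].
move=> U'' oU'' sU'' AU''; apply: HC => //.
exact: subset_trans sU'' sU'.
Qed.

End SmoothAverage.

Section Naturality.
Variables (R : realType) (G : lie_groupoid R) (E : graded_vbundle (objects G)).
Variable rho : ruth E.

Lemma lcoboundary_natural (L L' : objects G -> Type) (F : forall x, L' x -> L x)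
    (C : lcochains E L) :
  lcoboundary rho (fun i j g (y : decoration L' g) => C i j g (fun k => F _ (y k))) =
  (fun i j g (y : decoration L' g) => lcoboundary rho C j (fun k => F _ (y k))).
Proof. by apply: lcochainsP => k j g y; case: k g y. Qed.

Lemma coboundary_lcoboundary (C : lcochains E (fun=> unit)) :
  coboundary rho (fun i j g => C i j g (fun=> tt)) =
  (fun i j g => lcoboundary rho C j (fun=> tt)).
Proof. by apply: cochainsP => k j g; case: k g. Qed.

End Naturality.

Section Descent.
Variables (R : realType) (G' G : lie_groupoid R) (phi : groupoid_morphism G' G).
Variable h : hypercover_fp phi -> arrows G'.
Hypothesis hK : cancel (hypercover_fp_map phi) h.
Hypothesis Kh : cancel h (hypercover_fp_map phi).
Hypothesis sh : forall k (U : set 'rV[R]_k) (p : 'rV[R]_k -> hypercover_fp phi),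
  open U -> plot U (@fp_tgt _ _ _ phi \o p) -> plot U (@fp_src _ _ _ phi \o p) ->
  plot U (@fp_arrow _ _ _ phi \o p) -> plot U (h \o p).
Variables (w : nat -> objects G -> R) (A : nat -> set (objects G)).
Hypothesis sw : forall k, plot_smooth (w k).
Hypothesis oA : forall k, open (A k).
Hypothesis wA : forall k x, ~ A k x -> \forall y \near x, w k y = 0.
Variable N : objects G -> nat.
Hypothesis Nw : forall x, \forall y \near x, forall k, (N x <= k)%N -> w k y = 0.
Hypothesis w1 : forall x n, (forall k, (n <= k)%N -> w k x = 0) ->
  \sum_(k < n) w k x = 1.
Variable s : nat -> forall x, object_lift phi x.
Hypothesis ss : forall l k (U : set 'rV[R]_k) (p : 'rV[R]_k -> objects G),
  open U -> plot U p -> (forall u, U u -> A l (p u)) ->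
  plot U (fun u => sval (s l (p u))).
Variables (E : graded_vbundle (objects G)) (rho : ruth E).
Local Notation E' := (graded_pullback phi E).
Local Notation lift c := (lift_cochain hK Kh c).

Let w0 := weight_bound Nw.

Definition descend (c : cochains E') : cochains E := fun i j g =>
  average w s N
    (fun i j g (y : decoration (prod_type (fun=> unit) (object_lift phi)) g) =>
    lift c j (fun k => (y k).2)) j (fun=> tt).

Definition descend_homotopy (c : cochains E') : cochains E' :=
  restrict_cochain (average w s N (prism (lift c))).

Lemma descend_coboundary (c : cochains E') :
  coboundary rho (descend c) = descend (coboundary (ruth_pullback phi rho) c).
Proof.
rewrite /descend (coboundary_lcoboundary rho (average w s N _)).
apply: cochainsP => i j g; rewrite (average_coboundary rho s w0 w1).
rewrite (lcoboundary_natural rho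
  (fun x (y : prod_type (fun=> unit) (object_lift phi) x) => y.2)).
by rewrite (lcoboundary_lift hK Kh rho).
Qed.

Lemma descend_pullback (c : cochains E) : descend (cochain_pullback phi c) = c.
Proof.
apply: cochainsP => i j g; rewrite /descend (lift_cochain_pullback hK Kh) /average.
by rewrite -scaler_suml (sum_weight w0 w1) scale1r.
Qed.

Lemma descend_homotopyP (c : cochains E') :
  coboundary (ruth_pullback phi rho) c = 0 ->
  coboundary (ruth_pullback phi rho) (descend_homotopy c) =
  c - cochain_pullback phi (descend c).
Proof.
move=> dc; rewrite restrict_coboundary.
rewrite -[X in X - _](restrict_lift_cochain hK Kh c).
apply: cochainsP => i j g; rewrite /restrict_cochain (average_coboundary rho s w0 w1).
have dl : lcoboundary rho (lift c) = fun _ _ _ _ => 0.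
  rewrite (lcoboundary_lift hK Kh rho) dc; apply: lcochainsP => i' j' g' y.
  by rewrite /lift_cochain linear0.
rewrite /average.
under eq_bigr => f _.
  have := prism_homotopy rho (lift c) j (label s (canonical_lift phi g) (fun k => f k)).
  rewrite dl {2}/prism big1 ?scaler0 ?addr0; last by move=> k _; rewrite linear0 scaler0.
  move=> ->; rewrite scalerBr; over.
by rewrite /= sumrB -scaler_suml (sum_weight w0 w1) scale1r.
Qed.

Lemma lift_chain_plot n k (U : set 'rV[R]_k) (p : 'rV[R]_k -> chain G n)
    (y : forall u, decoration (object_lift phi) (p u)) :
  open U -> chain_plot U p -> (forall l, plot U (fun u => sval (y u l))) ->
  chain_plot U (fun u => lift_chain hK Kh (y u)).
Proof.
move=> oU [_ pa] py; split=> [l|l m lm]; first exact: py.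
apply: (sh (p := fun u => lift_fp (y u) lm)) => //.
- exact: (py m).
- exact: (py l).
- exact: (pa l m lm).
Qed.

Lemma lift_cochain_smooth (c : cochains E') i j k (U : set 'rV[R]_k)
    (p : 'rV[R]_k -> chain G i) (y : forall u, decoration (object_lift phi) (p u))
    (a : triv_index (E (- j))) :
  smooth_section (c i j) -> open U -> chain_plot U p ->
  (forall l, plot U (fun u => sval (y u l))) ->
  (forall u, U u -> triv_dom a (chain_tgt (p u))) ->
  smooth U (fun u => triv (E (- j)) a (chain_tgt (p u)) (lift c j (y u))).
Proof.
move=> sc oU pp py aU r.
have e u : on_objects phi (chain_tgt (lift_chain hK Kh (y u))) = chain_tgt (p u).
  exact: (svalP (y u ord_max)).
have pl := lift_chain_plot oU pp py.
apply: (@diff_class_ext _ _ _ _ _ (fun u => triv (E' (- j)) a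
   (chain_tgt (lift_chain hK Kh (y u))) (c i j (lift_chain hK Kh (y u))))) => //.
  by move=> u _; rewrite /lift_cochain (triv_cast _ _ (e u)).
apply: (sc _ _ _ oU pl) => u Uu.
by rewrite -[triv_dom _ _]/(triv_dom a (on_objects phi _)) e; exact: aU.
Qed.

Lemma descend_is_cochain n (c : cochains E') :
  is_cochain n c -> is_cochain n (descend c).
Proof.
move=> [sc cn [M cM]]; split=> [i j k U p oU pp a aU|i j ij g|].
- apply: (average_smooth sw oA wA Nw) => // U' f oU' U'U U'A.
  have pp' : chain_plot U' p.
    by split=> [l|l m lm]; [exact: plot_sub (pp.1 l)|exact: plot_sub (pp.2 l m lm)].
  apply: lift_cochain_smooth => //; last by move=> u /U'U; exact: aU.
  move=> l; apply: (ss (p := fun u => obj (p u) l)) => //; first exact: pp'.1.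
  by move=> u U'u; exact: U'A.
- by rewrite /descend /average big1 // => f _; rewrite /lift_cochain cn // linear0 scaler0.
- exists M => i j Mi g; rewrite /descend /average big1 // => f _.
  by rewrite /lift_cochain cM // linear0 scaler0.
Qed.

Lemma descend_homotopy_is_cochain n (c : cochains E') :
  is_cochain n c -> is_cochain (n - 1) (descend_homotopy c).
Proof.
move=> [sc cn [M cM]].
have zero i j : (forall g, c i.+1 j g = 0) ->
    forall g : chain G' i, descend_homotopy c j g = 0.
  move=> c0 g; rewrite /descend_homotopy /restrict_cochain /average big1 // => f _.
  rewrite /prism big1 ?scaler0 // => k _.
  by rewrite /lift_cochain c0 !linear0.
split=> [i j k U p oU pp a aU|i j ij|].
- rewrite /descend_homotopy /restrict_cochain.
  have pc := chain_map_plot phi oU pp.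
  apply: (average_smooth sw oA wA Nw (p := @chain_map _ _ _ phi i \o p)
    (y := fun u => canonical_lift phi (p u)) oU pc) => U' f oU' U'U U'A r.
  have pc' : chain_plot U' (@chain_map _ _ _ phi i \o p).
    by split=> [l|l m lm]; [exact: plot_sub (pc.1 l)|exact: plot_sub (pc.2 l m lm)].
  have tE k' (q : chain G i) : chain_tgt (subchain q (sigma_map k')) = chain_tgt q.
    congr (obj q _); apply: val_inj => /=; rewrite /unbump.
    by have := ltn_ord k'; lia.
  pose Y u := label s (canonical_lift phi (p u)) f.
  apply: (@diff_class_ext _ _ _ _ _ (fun u => (-1 : R) ^ (i%:Z + j) *:
     \sum_(k' < i.+1) (-1) ^+ k' *:
       triv (E (- j)) a (chain_tgt (subchain (chain_map phi (p u)) (sigma_map k')))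
         (lift c j (mix (Y u) (sigma_map k') (fun l => (l <= k')%N))))) => //.
    move=> u _; rewrite /prism [in RHS]linearZ [in RHS]linear_sum /=; congr (_ *: _).
    apply: eq_bigr => k' _; rewrite linearZ /=.
    by rewrite (triv_cast _ _ (tE k' (chain_map phi (p u)))).
  apply: diff_classZ => //; apply: diff_class_sum => // k'; apply: diff_classZ => //.
  apply: (lift_cochain_smooth (p := fun u => subchain (chain_map phi (p u)) (sigma_map k'))
    (y := fun u => mix (Y u) (sigma_map k') (fun l => (l <= k')%N))) => //.
  + split=> [l|l m lm]; first exact: (pc'.1 (sigma_map k' l)).
    exact: (pc'.2 _ _ (order_funP (sigma_map k') lm)).
  + move=> l; rewrite /mix; case: (l <= k')%N.
      exact: plot_sub (pp.1 (sigma_map k' l)).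
    apply: (ss (p := fun u => obj (chain_map phi (p u)) (sigma_map k' l))) => //.
      exact: (pc'.1 (sigma_map k' l)).
    by move=> u U'u; exact: U'A.
  + by move=> u /U'U Uu; rewrite tE; exact: aU.
- apply: zero => g; apply: cn; move: ij; apply: contra => /eqP <-.
  by apply/eqP; rewrite -addn1 PoszD; ring.
- exists M => i j Mi; apply: zero => g; apply: cM; exact: leqW.
Qed.

End Descent.

Section Main.
Variables (R : realType) (G' G : lie_groupoid R) (phi : groupoid_morphism G' G).

Definition smooth_section_set (A : set (objects G)) : Prop :=
  open A /\ exists s : forall x, object_lift phi x,
    forall k (U : set 'rV[R]_k) (p : 'rV[R]_k -> objects G), open U -> plot U p ->
      (forall u, U u -> A (p u)) -> plot U (fun u => sval (s (p u))).

Lemma smooth_section_cover :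
  submersion (on_objects phi) -> (forall x, exists x', on_objects phi x' = x) ->
  (forall x, exists A, [/\ open A, A x & smooth_section_set A]) /\
  smooth_section_set set0.
Proof.
move=> sub surj.
have t x : object_lift phi x by apply: cid; exact: surj.
split; last first.
  split; first exact: open0.
  exists t => k U p oU pp U0; split=> [u /U0|c ac r] //.
  by apply: diff_class_cover => u [/U0].
move=> x; have [x' <-] := surj x.
have [A [s [oA Ax As ss]]] := submersion_local_section x' sub.
exists A; split=> //; split=> //.
exists (fun y => if pselect (A y) is left Ay then exist _ (s y) (As y Ay) else t y).
move=> k U p oU pp UA; apply: (plot_ext oU) (ss k U p oU pp UA) => u Uu /=.
by case: pselect => // /(_ (UA u Uu)).
Qed.

Variables (E : graded_vbundle (objects G)) (rho : ruth E).

Lemma cochain_descent : hypercover phi ->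
  exists d : cochains (graded_pullback phi E) -> cochains E, [/\
    forall n c, is_cochain n c -> is_cochain n (d c),
    forall c, coboundary rho (d c) = d (coboundary (ruth_pullback phi rho) c),
    forall c, d (cochain_pullback phi c) = c &
    forall n c, is_cochain n c -> coboundary (ruth_pullback phi rho) c = 0 ->
      exists2 b, is_cochain (n - 1) b &
        coboundary (ruth_pullback phi rho) b = c - cochain_pullback phi (d c)].
Proof.
move=> [sub surj [h [hK Kh sh]]].
have [cov q0] := smooth_section_cover sub surj.
have [w [A [sw lfw w1 wA QA]]] := partition_of_unity cov q0.
have /choice[N Nw] := lfw.
have /choice[s ss] := fun k => (QA k).2.
have oA k := (QA k).1.
exists (fun c => descend hK Kh w N s c); split.
- by move=> n c; exact: (descend_is_cochain hK Kh sh sw oA wA Nw ss).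
- by move=> c; exact: descend_coboundary.
- by move=> c; exact: descend_pullback.
- move=> n c sc dc; exists (descend_homotopy hK Kh w N s c).
    exact: (descend_homotopy_is_cochain hK Kh sh sw oA wA Nw ss).
  exact: descend_homotopyP.
Qed.

End Main.

Theorem theorem1p3 (R : realType) (G' G : lie_groupoid R)
    (phi : groupoid_morphism G' G) (E : graded_vbundle (objects G))
    (rho : ruth E) (n : int) :
  hypercover phi -> bounded_grading E ->
  bijective (cohomology_pullback phi rho n :
    {linear cohomology rho n -> cohomology (ruth_pullback phi rho) n}).
Proof.
move=> hyp _; have [d [dcoch dcob dpull dhom]] := cochain_descent rho hyp.
have inj : injective (cohomology_pullback phi rho n).
  move=> y z; rewrite -[y]cohomology_reprK -[z]cohomology_reprK.
  move: (cohomology_repr y) (cohomology_repr z) => {}y {}z.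
  rewrite !cohomology_pullback_class => /cohomology_classP /asboolP[b cb db].
  apply/cohomology_classP/asboolP; exists (d b); first exact: dcoch.
  rewrite dcob db; exact: (dpull (y - z : cochains E)).
have surj z : exists y, cohomology_pullback phi rho n y = z.
  rewrite -[z]cohomology_reprK; move: (cohomology_repr z) => {}z.
  have /asboolP[cz dz] := valP z.
  have cd : is_cocycle rho n (d z).
    apply/asboolP; split; first exact: dcoch.
    by rewrite dcob dz -[RHS]dpull.
  exists (cohomology_class (Cocycle cd)); rewrite cohomology_pullback_class.
  apply/esym/cohomology_classP/asboolP.
  by have [b cb db] := dhom n z cz dz; exists b.
have /choice[f fK] := surj.
by exists f => [y|z]; [apply: inj; exact: fK|exact: fK].
Qed.
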